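(* There exists an absolute constant $C>0$ such that for every $n\ge 1$, every compact set $K\subseteq\mathbb{R}^n$ of positive volume, every Borel measurable function $f\ge 0$ on $K$, and every real $p>2$, $$\int_K f(x)\,dx\;\le\; C\sqrt{p}\;d_{\rm ovr}(K,L_p^n)\;|K|^{1/n}\;\sup_H\int_{K\cap H} f(x)\,dx,$$ where the supremum is taken over all affine hyperplanes $H$ in $\mathbb{R}^n$.
   Context: $(x,y)$ is the standard scalar product in $\mathbb{R}^n$, $S^{n-1}$ the Euclidean unit sphere centered at the origin, and $|K|$ denotes volume. The integral over $K\cap H$ is with respect to $(n-1)$-dimensional Lebesgue measure on $H$. A convex body is a compact convex set with non-empty interior; it is centrally-symmetric if $D=-D$; $\|x\|_D=\inf\{a\ge 0: x\in aD\}$. The class $L_p^n$ of unit balls of $n$-dimensional subspaces of $L_p$ is, equivalently, the class of all centrally-symmetric convex bodies $D\subseteq\mathbb{R}^n$ for which there is a finite Borel measure $\nu_D$ on $S^{n-1}$ with $\|x\|_D^p=\int_{S^{n-1}}|(x,\theta)|^p\,d\nu_D(\theta)$ for all $x\in\mathbb{R}^n$. For measurable bounded $K$ of positive volume, $$d_{\rm ovr}(K,L_p^n)=\inf\Big\{\Big(\frac{|D|}{|K|}\Big)^{1/n}: K\subseteq D,\ D\in L_p^n\Big\}.$$ *)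

(* Defs.v *)
From HB Require Import structures.
From mathcomp Require Import all_boot all_order all_algebra.
From mathcomp Require Import all_classical all_reals all_analysis.
From mathcomp Require Import measurable_realfun.

Set Implicit Arguments.
Unset Strict Implicit.
Unset Printing Implicit Defensive.

Import Order.TTheory GRing.Theory Num.Theory.
Import numFieldNormedType.Exports.

Local Open Scope classical_set_scope.
Local Open Scope ring_scope.

(* R^n is 'rV[R]_n, measurable for its Borel sigma-algebra. *)
HB.instance Definition _ (R : realType) (n : nat) :=
  @isMeasurable.Build (sigma_display (@open 'rV[R]_n)) 'rV[R]_n
    <<s @open 'rV[R]_n >> (@sigma_algebra0 _ setT _)
    (@sigma_algebraC _ (@open 'rV[R]_n)) (@sigma_algebra_bigcup _ setT _).

Section borel.
Variable R : realType.

Lemma open_measurable_rV n (A : set 'rV[R]_n) : open A -> measurable A.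
Proof. by move=> oA; exact: sub_sigma_algebra. Qed.

Lemma continuous_measurable_rV n m (f : 'rV[R]_n -> 'rV[R]_m) :
  continuous f -> measurable_fun setT f.
Proof.
move=> cf; apply: (@measurability _ _ _ _ setT f (@open 'rV[R]_m)) => //.
move=> _ [B oB <-]; rewrite setTI.
by apply: open_measurable_rV; move/continuousP : cf; exact.
Qed.

Lemma measurable_coord n (i : 'I_n) :
  measurable_fun setT (fun x : 'rV[R]_n => x ord0 i).
Proof.
apply: (measurability _ (RGenOpens.measurableE R)) => _ [_ [a [b ->] <-]].
rewrite setTI; apply: open_measurable_rV.
by apply: open_comp; [move=> x _; exact: coord_continuous|exact: interval_open].
Qed.

Lemma measurable_rVP d (T : measurableType d) n (f : T -> 'rV[R]_n) :
  (forall i, measurable_fun setT (fun t => f t ord0 i)) -> measurable_fun setT f.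
Proof.
move=> mf; apply: (@measurability _ _ _ _ setT f (@open 'rV[R]_n)) => //.
move=> _ [B oB <-]; rewrite setTI.
pose c (q : 'rV[rat]_n) : 'rV[R]_n := map_mx ratr q.
pose e (k : nat) : R := k.+1%:R^-1.
pose box (p : 'rV[rat]_n * nat) : set T := f @^-1` ball (c p.1) (e p.2).
have e0 k : 0 < e k by rewrite invr_gt0 ltr0n.
have boxE p : box p = \bigcap_(i in [set: 'I_n])
    ((fun t => f t ord0 i) @^-1` ball (c p.1 ord0 i) (e p.2)).
  apply/seteqP; split=> t /=.
    by move=> [_ h] i _; exact: h.
  by move=> h; split=> // i j; rewrite (ord1 i); exact: h.
have mbox p : measurable (box p).
  rewrite boxE; apply: fin_bigcap_measurable => // i _.
  rewrite -[X in measurable X]setTI; apply: mf => //.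
  by apply: open_measurable; exact: ball_open.
have -> : f @^-1` B = \bigcup_(p in [set: 'rV[rat]_n * nat])
    (if `[< ball (c p.1) (e p.2) `<=` B >] then box p else set0).
  apply/seteqP; split=> t /=; last first.
    by move=> [p _]; case: asboolP => // h /= /h.
  move=> Bft.
  have /nbhs_ballP[r /= r0 rB] : nbhs (f t) B by apply: open_nbhs_nbhs; split.
  have [k kr] : exists k, e k < r / 2.
    have r20 : 0 < r / 2 by rewrite divr_gt0.
    have [k _ kr] := near_infty_natSinv_lt (PosNum r20); exists k; exact: (kr k (leqnn k)).
  have /choice[q qP] i : exists q : rat, ball (f t ord0 i) (e k) (ratr q : R).
    have := @dense_rat R (ball (f t ord0 i) (e k)).
    case; [by exists (f t ord0 i); exact: ballxx|exact: ball_open|].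
    by move=> y [fy [q _ qy]]; exists q; rewrite qy.
  have cqt : ball (c (\row_i q i)) (e k) (f t).
    by split=> // i j; rewrite (ord1 i) !mxE; exact/ball_sym/qP.
  exists (\row_i q i, k) => //=; case: asboolP => // -[] y yc; apply: rB.
  have : ball (f t) (e k + e k) y by apply: ball_triangle yc; exact: ball_sym.
  by apply: le_ball; rewrite (splitr r) lerD// ltW.
apply: countable_bigcupT_measurable => // p.
by case: ifP.
Qed.

End borel.

Section lebesgue_cons.
Variables (R : realType) (n : nat).

Definition cons_rV (z : R * 'rV[R]_n) : 'rV[R]_n.+1 := row_mx (z.1)%:M z.2.

Definition lebesgue_cons (mu : set 'rV[R]_n -> \bar R) :
    set 'rV[R]_n.+1 -> \bar R :=
  pushforward (lebesgue_measure \x mu)%E cons_rV.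

Lemma measurable_cons_rV : measurable_fun setT cons_rV.
Proof.
apply: measurable_rVP => i; case: (@splitP 1 n i) => [j ij|j ij].
  rewrite (_ : (fun t => _) = fst) ?measurable_fst//; apply/funext => z.
  have -> : i = lshift n j by exact: val_inj.
  by apply: (etrans (row_mxEl _ _ _ _)); rewrite (ord1 j) mxE.
rewrite (_ : (fun t => _) = (fun x : 'rV[R]_n => x ord0 j) \o snd).
  by apply: measurableT_comp => //; exact: measurable_coord.
apply/funext => z; have -> : i = rshift 1 j by exact: val_inj.
exact: row_mxEr.
Qed.

Variable mu : {sigma_finite_measure set 'rV[R]_n -> \bar R}.

Let preimage_cons A : measurable A -> measurable (cons_rV @^-1` A).
Proof. by move=> mA; rewrite -[X in measurable X]setTI; exact: measurable_cons_rV. Qed.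

Let lebesgue_cons0 : lebesgue_cons mu set0 = 0%E.
Proof. by rewrite /lebesgue_cons /pushforward preimage_set0 measure0. Qed.

Let lebesgue_cons_ge0 A : (0 <= lebesgue_cons mu A)%E.
Proof. by rewrite /lebesgue_cons /pushforward measure_ge0. Qed.

Let lebesgue_cons_sigma_additive : semi_sigma_additive (lebesgue_cons mu).
Proof.
move=> F mF tF mUF; rewrite /lebesgue_cons /pushforward preimage_bigcup.
apply: measure_semi_sigma_additive.
- by move=> k; exact: preimage_cons.
- apply/trivIsetP => /= i j _ _ ij; rewrite -preimage_setI.
  by move/trivIsetP : tF => /(_ _ _ _ _ ij) ->//; rewrite preimage_set0.
- by rewrite -preimage_bigcup; exact: preimage_cons.
Qed.

HB.instance Definition _ := isMeasure.Build _ _ _ (lebesgue_cons mu)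
  lebesgue_cons0 lebesgue_cons_ge0 lebesgue_cons_sigma_additive.

Let lebesgue_cons_sigma_finite : sigma_finite setT (lebesgue_cons mu).
Proof.
have /sigma_finiteP[F [TF ndF Foo]] :=
  sigma_finiteT (@lebesgue_measure R : {sigma_finite_measure set _ -> \bar R}).
have /sigma_finiteP[G [TG ndG Goo]] := sigma_finiteT mu.
pose uncons (v : 'rV[R]_(1 + n)) : R * 'rV[R]_n := (v ord0 ord0, rsubmx v).
have consK z : uncons (cons_rV z) = z.
  case: z => [t y]; rewrite /uncons /cons_rV row_mxKr; congr pair.
  have -> : ord0 = lshift n (ord0 : 'I_1) :> 'I_(1 + n) by exact: val_inj.
  by rewrite row_mxEl mxE.
have muncons : measurable_fun setT uncons.
  apply/measurable_fun_pair; first exact: measurable_coord.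
  apply: measurable_rVP => i.
  apply: (eq_measurable_fun (fun v : 'rV[R]_(1 + n) => v ord0 (rshift 1 i))).
    by move=> v _; rewrite mxE.
  exact: measurable_coord.
exists (fun k => uncons @^-1` (F k `*` G k)).
  rewrite -preimage_bigcup (_ : \bigcup_k _ = setT) ?preimage_setT//.
  rewrite -subTset => -[x y] _.
  have [k _ Fkx] : (\bigcup_k F k) x by rewrite -TF.
  have [l _ Gly] : (\bigcup_k G k) y by rewrite -TG.
  exists (maxn k l) => //; split => /=.
  - by move: x Fkx; exact/subsetPset/ndF/leq_maxl.
  - by move: y Gly; exact/subsetPset/ndG/leq_maxr.
move=> k; have [mF Fk] := Foo k; have [mG Gk] := Goo k; split.
  by rewrite -[X in measurable X]setTI; apply: muncons => //; exact: measurableX.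
rewrite /lebesgue_cons /pushforward -comp_preimage.
rewrite (_ : uncons \o _ = id) ?preimage_id; last exact/funext.
by rewrite product_measure1E// lte_mul_pinfty// ge0_fin_numE.
Qed.

HB.instance Definition _ := Measure_isSigmaFinite.Build _ _ _ (lebesgue_cons mu)
  lebesgue_cons_sigma_finite.

End lebesgue_cons.

(* n-dimensional Lebesgue measure, as the n-fold product of the Lebesgue
   measure of R; for n = 0 it is the unit mass at the only point of R^0. *)
Fixpoint lebesgue_rV (R : realType) (n : nat) :
    {sigma_finite_measure set 'rV[R]_n -> \bar R} :=
  if n is m.+1 then lebesgue_cons (lebesgue_rV R m) else \d_(0 : 'rV[R]_0).

Arguments lebesgue_rV {R n}.

Lemma lebesgue_rV_box (R : realType) (n : nat) (A : 'I_n -> set R) :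
  (forall i, measurable (A i)) ->
  lebesgue_rV [set x | forall i, A i (x ord0 i)] =
  (\prod_(i < n) lebesgue_measure (A i))%E.
Proof.
elim: n A => [|n IH] A mA.
  by rewrite big_ord0 /= diracE mem_set//= => -[].
rewrite big_ord_recl -IH//= /lebesgue_cons /pushforward.
pose B := [set y : 'rV[R]_n | forall i, A (lift ord0 i) (y ord0 i)].
have mB : measurable B.
  rewrite (_ : B = \bigcap_(i in [set: 'I_n])
      ((fun y : 'rV[R]_n => y ord0 i) @^-1` A (lift ord0 i))); last first.
    by apply/seteqP; split=> y /= h => [i _|i]; exact: h.
  apply: fin_bigcap_measurable => // i _.
  by rewrite -[X in measurable X]setTI; exact: measurable_coord.
have e0 (z : R * 'rV[R]_n) : cons_rV z ord0 ord0 = z.1.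
  have -> : ord0 = lshift n (ord0 : 'I_1) :> 'I_(1 + n) by exact: val_inj.
  by apply: (etrans (row_mxEl _ _ _ _)); rewrite mxE.
have eS (z : R * 'rV[R]_n) i : cons_rV z ord0 (lift ord0 i) = z.2 ord0 i.
  have -> : lift ord0 i = rshift 1 i :> 'I_(1 + n) by exact: val_inj.
  exact: row_mxEr.
rewrite (_ : _ @^-1` _ = A ord0 `*` B) ?product_measure1E//; first exact: mA.
apply/seteqP; split=> z /=.
  by move=> h; split=> [|i]; [rewrite -e0|rewrite -eS]; exact: h.
move=> [z1 z2] i; case: (unliftP ord0 i) => [j|] ->; first by rewrite eS; exact: z2.
by rewrite e0.
Qed.

Section convex_bodies.
Variables (R : realType) (n : nat).
Implicit Types (x y : 'rV[R]_n) (D K : set 'rV[R]_n).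

Definition dotp x y : R := \sum_(i < n) x ord0 i * y ord0 i.

(* `|x| is the sup norm on 'rV[R]_n; the Euclidean norm is defined here. *)
Definition enorm x : R := Num.sqrt (dotp x x).

Definition unit_sphere : set 'rV[R]_n := [set x | enorm x = 1].

Definition convex_body D := [/\ compact D, convex_set D & D° !=set0].

Definition centrally_symmetric D := D = [set - x | x in D].

Definition minkowski_functional D x : R :=
  inf [set a : R | 0 <= a /\ [set a *: y | y in D] x].

(* A finite Borel measure on the sphere is encoded as a finite Borel measure
   on R^n that vanishes outside the sphere. *)
Definition Lp_ball (p : R) D :=
  [/\ convex_body D, centrally_symmetric D &
    exists nu : {finite_measure set 'rV[R]_n -> \bar R},
      nu (~` unit_sphere) = 0%E /\
      forall x, ((minkowski_functional D x `^ p)%:E =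
        \int[nu]_(theta in unit_sphere) (`|dotp x theta| `^ p)%:E)%E].

Definition d_ovr (p : R) K : \bar R :=
  ereal_inf [set ((lebesgue_rV D / lebesgue_rV K) `^ n%:R^-1)%E |
    D in [set D | K `<=` D /\ Lp_ball p D]].

End convex_bodies.

Section hyperplanes.
Variables (R : realType) (n : nat).
Implicit Type H : set 'rV[R]_n.

Definition affine_hyperplane H :=
  exists (theta : 'rV[R]_n) (t : R), theta != 0 /\ H = [set x | dotp x theta = t].

Definition affine_map (c : 'rV[R]_n * 'M[R]_(n.-1, n)) (y : 'rV[R]_n.-1) :
  'rV[R]_n := c.1 + y *m c.2.

(* The rows of c.2 are orthonormal, so affine_map c is an isometry of R^(n-1)
   onto H. *)
Definition isometric_chart H (c : 'rV[R]_n * 'M[R]_(n.-1, n)) :=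
  c.2 *m c.2^T = 1%:M /\ range (affine_map c) = H.

(* (n-1)-dimensional Lebesgue measure on H, carried over from R^(n-1) by an
   isometric chart; it does not depend on the chart, since two charts of H
   differ by an isometry of R^(n-1). It is only meant for hyperplanes H. *)
Definition hyperplane_measure H : set 'rV[R]_n -> \bar R :=
  pushforward (@lebesgue_rV R n.-1) (affine_map (get (isometric_chart H))).

Lemma measurable_affine_map c : measurable_fun setT (affine_map c).
Proof.
apply: measurable_rVP => i.
apply: (eq_measurable_fun
    (fun y : 'rV[R]_n.-1 => c.1 ord0 i + \sum_(j < n.-1) y ord0 j * c.2 j i)).
  by move=> y _; rewrite /affine_map !mxE.
apply: measurable_funD => //; apply: measurable_sum => j.
by apply: measurable_funM => //; exact: measurable_coord.
Qed.

HB.instance Definition _ H := Measure.copy (hyperplane_measure H)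
  (measure_function_pushforward__canonical__measure_function_Measure
    (@lebesgue_rV R n.-1) (@measurable_affine_map (get (isometric_chart H)))).

End hyperplanes.

(* Main.v *)
(* Let M be the supremum of the hyperplane integrals and m the integral of f over
   K.  By Tonelli, every slab |(x, theta)| <= a has f-mass at most 2 a M.  If
   K lies in D and ||x||_D ^ p is the nu-average of |(x, theta)| ^ p, then
   averaging over theta with a ^ p = 2 / nu(S) gives m <= 4 a M.  On the other
   hand (x, theta) is subgaussian on the unit cube, so ||x||_D ^ p has mean at
   most 2 nu(S) p ^ (p / 2) there; hence half of the cube lies in r D with
   r = (4 nu(S)) ^ (1 / p) sqrt p, and |D| ^ (1 / n) >= 1 / (2 r).  As
   a r <= 8 sqrt p, this yields m <= 64 sqrt p |D| ^ (1 / n) M. *)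
Require Import Defs.
From HB Require Import structures.
From mathcomp Require Import all_boot all_order all_algebra.
From mathcomp Require Import all_classical all_reals all_analysis.
From mathcomp Require Import measurable_realfun ring lra.
Import Order.TTheory GRing.Theory Num.Theory.
Import numFieldNormedType.Exports.
Local Open Scope classical_set_scope.
Local Open Scope ring_scope.
Set Implicit Arguments.
Unset Strict Implicit.
Unset Printing Implicit Defensive.

(** * Lebesgue measure on R^n *)

Section lebesgue_rV_theory.
Context {R : realType}.
Local Open Scope ereal_scope.

(** Lebesgue measure is built here as a product along the coordinates, and the measure on a
    hyperplane is transported by a chart picked by choice, whereas the slabs point in every
    direction theta. Slicing along theta therefore rests on invariance under orthogonal maps. It
    comes from the uniqueness of translation-invariant measures, with the Euclidean ball as test
    set. The body D is known only through nu, whose mass is not normalized. Working with p-th powers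
    lets both estimates integrate in x first, for a fixed unit vector theta, and in theta
    afterwards. The mass then enters a as nu(S)^(-1/p) and r as nu(S)^(1/p), and it cancels in a r.
    The unit cube serves as reference set because its volume is one and the exponential of a linear
    form factors over its coordinates. The constant is 64 = 4 * 2 * 8: 4 from the slab estimate, 2
    from the half of the cube kept by Markov's inequality, and 8 from the product of 2 / nu(S) and 4
    nu(S). *)

Lemma ge0_integral_lebesgue_shift (f : R -> \bar R) (v : R) :
  measurable_fun setT f -> (forall x, 0 <= f x) ->
  \int[lebesgue_measure]_x f (x + v)%R = \int[lebesgue_measure]_x f x.
Proof.
move=> mf f0.
have mv : measurable_fun setT (fun x : measurableTypeR R => (x + v)%R : measurableTypeR R).
  by apply: measurable_funD.
transitivity (\int[pushforward lebesgue_measure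
    (fun x : measurableTypeR R => (x + v)%R : measurableTypeR R)]_x f x).
  by rewrite (ge0_integral_pushforward mv).
apply: eq_measure_integral => A mA _.
apply/esym/(lebesgue_measure_unique
  (mu := measure_function_pushforward__canonical__measure_function_Measure
     lebesgue_measure mv)) => //= _ [[a b]] _ <-.
rewrite /pushforward.
rewrite (_ : _ @^-1` _ = `](a - v)%R, (b - v)%R]%classic); last first.
  by apply/seteqP; split=> x /=; rewrite !in_itv/= ltrBlDr lerBrDr.
rewrite !lebesgue_measure_itv/= !lte_fin ltrD2r.
by case: ifPn => // _; rewrite -!EFinB opprB addrA subrK.
Qed.

Lemma ge0_integral_lebesgue_rVS n (f : 'rV[R]_n.+1 -> \bar R) :
  measurable_fun setT f -> (forall x, 0 <= f x) ->
  \int[lebesgue_rV]_x f x =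
  \int[lebesgue_measure]_t \int[lebesgue_rV]_y f (cons_rV (t, y)).
Proof.
move=> mf f0.
have mc : measurable_fun [set: measurableTypeR R * 'rV[R]_n] (@cons_rV R n).
  exact: measurable_cons_rV.
apply: (etrans (ge0_integral_pushforward mc (lebesgue_measure \x lebesgue_rV)%E
  measurableT mf (in1W f0))).
rewrite preimage_setT.
rewrite fubini_tonelli1//; last by move=> x /=.
by apply: measurableT_comp => //; exact: measurable_cons_rV.
Qed.

Lemma cons_rV_ord0 n (z : R * 'rV[R]_n) : cons_rV z ord0 ord0 = z.1.
Proof.
have -> : ord0 = lshift n (ord0 : 'I_1) :> 'I_(1 + n) by exact: val_inj.
by apply: (etrans (row_mxEl _ _ _ _)); rewrite mxE.
Qed.

Lemma cons_rV_lift n (z : R * 'rV[R]_n) i : cons_rV z ord0 (lift ord0 i) = z.2 ord0 i.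
Proof.
have -> : lift ord0 i = rshift 1 i :> 'I_(1 + n) by exact: val_inj.
exact: row_mxEr.
Qed.

Lemma cons_rVD n (t s : R) (y z : 'rV[R]_n) :
  (cons_rV (t, y) + cons_rV (s, z) = cons_rV (t + s, y + z)%R)%R.
Proof.
apply/rowP => i; rewrite mxE; case: (unliftP ord0 i) => [j|] ->.
  by rewrite !cons_rV_lift/= mxE.
by rewrite !cons_rV_ord0.
Qed.

Lemma cons_rV_surj n (v : 'rV[R]_n.+1) : exists t y, v = cons_rV (t, y).
Proof.
exists (v ord0 ord0), (\row_i v ord0 (lift ord0 i))%R; apply/rowP => i.
case: (unliftP ord0 i) => [j|] ->; first by rewrite cons_rV_lift/= mxE.
by rewrite cons_rV_ord0.
Qed.

Lemma measurable_fun_integral_cons_rV n (f : 'rV[R]_n.+1 -> \bar R) :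
  measurable_fun setT f -> (forall x, 0 <= f x) ->
  measurable_fun setT (fun t : R => \int[lebesgue_rV]_y f (cons_rV (t, y))).
Proof.
move=> mf f0.
have mfc : measurable_fun [set: measurableTypeR R * 'rV[R]_n] (f \o @cons_rV R n).
  by apply: measurableT_comp => //; exact: measurable_cons_rV.
exact: (@measurable_fun_fubini_tonelli_F _ _ _ _ R lebesgue_rV _ mfc (fun x => f0 _)).
Qed.

Lemma measurable_fun_cons_rV n (f : 'rV[R]_n.+1 -> \bar R) t :
  measurable_fun setT f ->
  measurable_fun setT (fun y => f (cons_rV (t, y))).
Proof.
move=> mf; apply: (measurableT_comp mf).
exact: (measurableT_comp (@measurable_cons_rV R n) (measurable_pair1 t)).
Qed.

Lemma measurable_rV_addr n (v : 'rV[R]_n) : measurable_fun setT (fun x : 'rV[R]_n => (x + v)%R).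
Proof.
apply: measurable_rVP => i; apply: (eq_measurable_fun (fun x : 'rV[R]_n => (x ord0 i + v ord0 i)%R)).
  by move=> x _; rewrite mxE.
by apply: measurable_funD => //; exact: measurable_coord.
Qed.

(** Tonelli along the first coordinate splits the translation into one of R and one in dimension one
    less. *)
Lemma ge0_integral_lebesgue_rV_shift n (f : 'rV[R]_n -> \bar R) (v : 'rV[R]_n) :
  measurable_fun setT f -> (forall x, 0 <= f x) ->
  \int[lebesgue_rV]_x f (x + v)%R = \int[lebesgue_rV]_x f x.
Proof.
elim: n f v => [|n IH] f v mf f0.
  by apply: eq_integral => x _; congr f; rewrite [x]thinmx0 [v]thinmx0 addr0.
have [s [z ->]] := cons_rV_surj v.
have mfv w : measurable_fun setT (fun x : 'rV[R]_n.+1 => f (x + w)%R).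
  by apply: measurableT_comp => //; exact: measurable_rV_addr.
rewrite ge0_integral_lebesgue_rVS// [RHS]ge0_integral_lebesgue_rVS//.
rewrite -[RHS](ge0_integral_lebesgue_shift s); last 2 first.
- exact: measurable_fun_integral_cons_rV.
- by move=> t; exact: integral_ge0.
apply: eq_integral => t _.
under eq_integral do rewrite cons_rVD.
rewrite (IH (fun y => f (cons_rV (t + s, y)%R)))//.
exact: measurable_fun_cons_rV.
Qed.

End lebesgue_rV_theory.

(** * Uniqueness of the translation-invariant measure *)

Section lebesgue_rV_unique.
Context {R : realType}.
Local Open Scope ereal_scope.

Lemma measurable_rVD d (X : measurableType d) n (f g : X -> 'rV[R]_n) :
  measurable_fun setT f -> measurable_fun setT g ->
  measurable_fun setT (fun x => (f x + g x)%R).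
Proof.
move=> mf mg; apply: measurable_rVP => i.
apply: (eq_measurable_fun (fun x => (f x ord0 i + g x ord0 i)%R)).
  by move=> x _; rewrite mxE.
by apply: measurable_funD; exact: (measurableT_comp (measurable_coord i)).
Qed.

Lemma measurable_rVN d (X : measurableType d) n (f : X -> 'rV[R]_n) :
  measurable_fun setT f -> measurable_fun setT (fun x => (- f x)%R).
Proof.
move=> mf; apply: measurable_rVP => i.
apply: (eq_measurable_fun (fun x => (- f x ord0 i)%R)).
  by move=> x _; rewrite mxE.
by apply: measurableT_comp => //; exact: (measurableT_comp (measurable_coord i)).
Qed.

(* Uniqueness of a translation-invariant measure, in integrated form: evaluate
   the double integral of g(T x) h(y + T x) in both orders. *)
Lemma ge0_integral_lebesgue_rV_mul n (T : 'rV[R]_n -> 'rV[R]_n)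
    (g h : 'rV[R]_n -> \bar R) :
  measurable_fun setT T ->
  (forall y, exists x0, forall x, T (x + x0)%R = (T x + y)%R) ->
  measurable_fun setT g -> (forall x, 0 <= g x) ->
  measurable_fun setT h -> (forall x, 0 <= h x) ->
  (\int[lebesgue_rV]_x g (T x)) * (\int[lebesgue_rV]_x h x) =
  (\int[lebesgue_rV]_x h (T x)) * (\int[lebesgue_rV]_x g (- x)%R).
Proof.
move=> mT shT mg g0 mh h0.
have mgT : measurable_fun setT (g \o T) by exact: measurableT_comp.
have mhT : measurable_fun setT (h \o T) by exact: measurableT_comp.
have mT1 : measurable_fun [set: 'rV[R]_n * 'rV[R]_n] (T \o fst).
  exact: measurableT_comp.
pose F1 (z : 'rV[R]_n * 'rV[R]_n) := g (T z.1) * h (z.2 + T z.1)%R.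
pose F2 (z : 'rV[R]_n * 'rV[R]_n) := h (T z.1) * g (T z.1 - z.2)%R.
have mF1 : measurable_fun setT F1.
  apply: emeasurable_funM; first exact: (measurableT_comp mgT).
  by apply: (measurableT_comp mh); exact: measurable_rVD.
have mF2 : measurable_fun setT F2.
  apply: emeasurable_funM; first exact: (measurableT_comp mhT).
  by apply: (measurableT_comp mg); apply: measurable_rVD => //; exact: measurable_rVN.
have F10 z : 0 <= F1 z by rewrite mule_ge0.
have F20 z : 0 <= F2 z by rewrite mule_ge0.
transitivity (\int[lebesgue_rV]_x \int[lebesgue_rV]_y F1 (x, y)).
  rewrite -ge0_integralZr//; last exact: integral_ge0.
  apply: eq_integral => x _; rewrite -(ge0_integral_lebesgue_rV_shift (T x) mh h0).
  rewrite -ge0_integralZl//.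
  by apply: (measurableT_comp mh); exact: measurable_rV_addr.
rewrite fubini_tonelli//.
(* For fixed [y], translating [x] by [x0] replaces [T x] by [T x + y], which turns [F2] into
   [F1]. *)
transitivity (\int[lebesgue_rV]_y \int[lebesgue_rV]_x F2 (x, y)).
  apply: eq_integral => y _; have [x0 Tx0] := shT y.
  rewrite -[RHS](ge0_integral_lebesgue_rV_shift x0)//; last first.
    exact: (measurableT_comp mF2 (measurable_pair2 y)).
  by apply: eq_integral => x _; rewrite /F1 /F2/= Tx0 addrK muleC addrC.
rewrite -(@fubini_tonelli _ _ _ _ R (@lebesgue_rV R n) (@lebesgue_rV R n) F2 mF2 F20).
rewrite -ge0_integralZr//; last exact: integral_ge0.
apply: eq_integral => x _.
have mgN : measurable_fun setT (fun x : 'rV[R]_n => g (- x)%R).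
  by apply: (measurableT_comp mg); exact: measurable_rVN.
rewrite -[in RHS](ge0_integral_lebesgue_rV_shift (- T x) mgN)//.
rewrite -ge0_integralZl//; last exact: (measurableT_comp mgN (measurable_rV_addr _)).
by apply: eq_integral => y _; rewrite /F2/= opprD opprK addrC.
Qed.

Lemma measurable_rV_box n (A : 'I_n -> set R) : (forall i, measurable (A i)) ->
  measurable [set x : 'rV[R]_n | forall i, A i (x ord0 i)].
Proof.
move=> mA.
rewrite (_ : [set _ | _] = \bigcap_(i in [set: 'I_n])
    ((fun y : 'rV[R]_n => y ord0 i) @^-1` A i)); last first.
  by apply/seteqP; split=> y /= h => [i _|i]; exact: h.
apply: fin_bigcap_measurable => // i _.
by rewrite -[X in measurable X]setTI; exact: measurable_coord.
Qed.

Lemma lebesgue_rV_bounded_lty n (A : set 'rV[R]_n) (M : R) :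
  measurable A -> (forall x, A x -> forall i, `|x ord0 i| <= M)%R ->
  lebesgue_rV A < +oo.
Proof.
move=> mA AM.
have mI (i : 'I_n) : measurable (`[(- M)%R, M]%classic : set R) by [].
have mB := measurable_rV_box mI.
apply: (@le_lt_trans _ _ (lebesgue_rV [set x : 'rV[R]_n |
    forall i, `[(- M)%R, M]%classic (x ord0 i)])).
  apply: le_measure; rewrite ?inE// => x /AM h i /=.
  by rewrite in_itv/= -ler_norml.
rewrite (lebesgue_rV_box mI).
have : \prod_(i < n) lebesgue_measure `[(- M)%R, M]%classic \is a fin_num.
  apply: prode_fin_num => i _.
  by rewrite lebesgue_measure_itv/=; case: ifP => // _; rewrite ltry.
by rewrite fin_numElt => /andP[].
Qed.

(** The Euclidean ball is the test set for orthogonal maps, since all of them preserve it. *)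
Definition unit_ball n := [set x : 'rV[R]_n | dotp x x <= 1]%R.

Lemma measurable_dotp d (X : measurableType d) n (f g : X -> 'rV[R]_n) :
  measurable_fun setT f -> measurable_fun setT g ->
  measurable_fun setT (fun x => dotp (f x) (g x)).
Proof.
move=> mf mg; apply: measurable_sum => i.
by apply: measurable_funM; exact: (measurableT_comp (measurable_coord i)).
Qed.

Lemma measurable_unit_ball n : measurable (@unit_ball n).
Proof.
rewrite [X in measurable X](_ : _ = (fun x : 'rV[R]_n => dotp x x) @^-1` `]-oo, 1%R]).
  by rewrite -[X in measurable X]setTI; exact: measurable_dotp.
by apply/seteqP; split=> x /=; rewrite in_itv.
Qed.

Lemma lebesgue_rV_unit_ball n : exists2 c : R, (0 < c)%R & lebesgue_rV (@unit_ball n) = c%:E.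
Proof.
have foo : lebesgue_rV (@unit_ball n) < +oo.
  apply: (@lebesgue_rV_bounded_lty _ _ 1%R); first exact: measurable_unit_ball.
  move=> x /= xB i; rewrite -(ler_pXn2r (n := 2))// ?nnegrE//.
  rewrite real_normK ?num_real// expr1n; apply: le_trans xB.
  rewrite /dotp (bigD1 i)//= -expr2 lerDl sumr_ge0// => j _.
  by rewrite -expr2 sqr_ge0.
suff pos : 0 < lebesgue_rV (@unit_ball n).
  exists (fine (lebesgue_rV (@unit_ball n))); first by rewrite fine_gt0// pos.
  by rewrite fineK// ge0_fin_numE// ltW.
(* The cube of half-side [d] lies in the ball: [d ^+ 2 <= d], so the [n] squares add up to at most
   [n / (n + 1)]. *)
pose d : R := (n.+1%:R^-1)%R.
have d0 : (0 < d)%R by rewrite invr_gt0.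
have mI (i : 'I_n) : measurable (`[(- d)%R, d]%classic : set R) by [].
apply: (@lt_le_trans _ _ (lebesgue_rV [set x : 'rV[R]_n |
    forall i, `[(- d)%R, d]%classic (x ord0 i)])).
  rewrite (lebesgue_rV_box mI); elim/big_ind : _ => [|x y|i _].
  - exact: lte01.
  - exact: mule_gt0.
  rewrite lebesgue_measure_itv/= lte_fin gtrN//.
  by rewrite -EFinD lte_fin opprK addr_gt0.
apply: le_measure; rewrite ?inE//.
- exact: (measurable_rV_box mI).
- exact: measurable_unit_ball.
- move=> x /= xd; rewrite /unit_ball/= /dotp.
  apply: (@le_trans _ _ (\sum_(i < n) d)%R).
    apply: ler_sum => i _; have := xd i; rewrite in_itv/= -ler_norml => xid.
    rewrite -expr2 -real_normK ?num_real//.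
    apply: (@le_trans _ _ (d ^+ 2)%R).
      by rewrite ler_pXn2r ?nnegrE// ltW.
    by rewrite expr2 ger_pMl// invf_le1 ?ltr0n// ler1n.
  rewrite sumr_const card_ord -mulr_natl /d ler_pdivrMr// mul1r ler_nat//.
Qed.

End lebesgue_rV_unique.

(** * Behaviour under reflections, orthogonal maps and dilations *)

Section lebesgue_rV_linear.
Context {R : realType}.
Local Open Scope ereal_scope.

Lemma mule_pinj (c : R) (x y : \bar R) : (0 < c)%R -> c%:E * x = c%:E * y -> x = y.
Proof.
move=> c0 xy; apply/eqP; rewrite eq_le.
have cm := @lee_pmul2l _ c%:E isT (c0 : 0 < c%:E).
by rewrite -cm -[X in _ && X]cm xy lexx.
Qed.

(** With the identity as [T] and the indicator of the ball as [h], both sides of the uniqueness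
    identity carry the same positive finite factor, which cancels. *)
Lemma ge0_integral_lebesgue_rV_opp n (g : 'rV[R]_n -> \bar R) :
  measurable_fun setT g -> (forall x, 0 <= g x) ->
  \int[lebesgue_rV]_x g (- x)%R = \int[lebesgue_rV]_x g x.
Proof.
move=> mg g0; have [c c0 cE] := @lebesgue_rV_unit_ball R n.
have mB := @measurable_unit_ball R n.
pose h : 'rV[R]_n -> \bar R := EFin \o \1_(@unit_ball R n).
have hE : \int[lebesgue_rV]_x h x = c%:E by rewrite integral_indic// setIT.
have := ge0_integral_lebesgue_rV_mul (T := id) (h := h) (@measurable_id _ _ _)
  (fun y => ex_intro _ y (fun=> erefl)) mg g0.
rewrite hE muleC => /(_ _ _)/esym H; apply: (mule_pinj c0); apply: H.
  exact/measurable_EFinP.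
by move=> x; rewrite lee_fin.
Qed.

(** [T] multiplies all integrals by one common factor, so the factor can be read off on a single
    convenient test set [Q]. *)
Lemma ge0_integral_lebesgue_rV_comp n (T : 'rV[R]_n -> 'rV[R]_n)
    (g : 'rV[R]_n -> \bar R) (Q : set 'rV[R]_n) :
  measurable_fun setT T ->
  (forall y, exists x0, forall x, T (x + x0)%R = (T x + y)%R) ->
  measurable_fun setT g -> (forall x, 0 <= g x) -> measurable Q ->
  (\int[lebesgue_rV]_x g (T x)) * lebesgue_rV Q =
  lebesgue_rV (T @^-1` Q) * \int[lebesgue_rV]_x g x.
Proof.
move=> mT shT mg g0 mQ.
have := ge0_integral_lebesgue_rV_mul (h := EFin \o \1_Q) mT shT mg g0.
rewrite ge0_integral_lebesgue_rV_opp// integral_indic// setIT.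
rewrite (_ : \int[_]_x (EFin \o \1_Q) (T x) = lebesgue_rV (T @^-1` Q)).
  by apply; [exact/measurable_EFinP|move=> x; rewrite lee_fin].
rewrite -[T @^-1` Q]setIT -integral_indic//.
by rewrite -[X in measurable X]setTI; exact: mT.
Qed.

Lemma dotp_mx n (x y : 'rV[R]_n) : dotp x y = (x *m y^T)%R ord0 ord0.
Proof. by rewrite mxE; apply: eq_bigr => i _; rewrite mxE. Qed.

Lemma measurable_mulmx d (X : measurableType d) n m (f : X -> 'rV[R]_n) (A : 'M[R]_(n, m)) :
  measurable_fun setT f -> measurable_fun setT (fun x => f x *m A)%R.
Proof.
move=> mf; apply: measurable_rVP => i.
apply: (eq_measurable_fun (fun x => \sum_(j < n) f x ord0 j * A j i)%R).
  by move=> x _; rewrite mxE.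
apply: measurable_sum => j; apply: measurable_funM => //.
exact: (measurableT_comp (measurable_coord j)).
Qed.

(** The unit ball is its own preimage under an orthogonal map, so the factor is 1. *)
Lemma ge0_integral_lebesgue_rV_orthogonal n (P : 'M[R]_n) (g : 'rV[R]_n -> \bar R) :
  (P *m P^T = 1%:M)%R ->
  measurable_fun setT g -> (forall x, 0 <= g x) ->
  \int[lebesgue_rV]_x g (x *m P)%R = \int[lebesgue_rV]_x g x.
Proof.
move=> PP mg g0; have PP' := mulmx1C PP.
have mP : measurable_fun setT (fun x : 'rV[R]_n => x *m P)%R by exact: measurable_mulmx.
have [c c0 cE] := @lebesgue_rV_unit_ball R n.
have := ge0_integral_lebesgue_rV_comp mP _ mg g0 (@measurable_unit_ball R n).
rewrite (_ : _ @^-1` _ = unit_ball (n := n)); last first.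
  apply/seteqP; split=> x; rewrite /unit_ball/= !dotp_mx trmx_mul mulmxA.
    by rewrite -(mulmxA x) PP mulmx1.
  by rewrite -(mulmxA x) PP mulmx1.
move=> h; apply: (mule_pinj c0); rewrite -cE muleC; apply: h => y.
exists (y *m P^T)%R => x.
by rewrite mulmxDl -mulmxA PP' mulmx1.
Qed.

Lemma measurable_rV_scale n (r : R) : measurable_fun setT (fun x : 'rV[R]_n => r *: x)%R.
Proof.
apply: (eq_measurable_fun (fun x : 'rV[R]_n => x *m r%:M)%R).
  by move=> x _; rewrite mul_mx_scalar.
exact: measurable_mulmx.
Qed.

Lemma dilation_preimage n (r : R) (D : set 'rV[R]_n) : (0 < r)%R ->
  [set (r *: x)%R | x in D] = (fun x => r^-1 *: x)%R @^-1` D.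
Proof.
move=> r0; apply/seteqP; split=> [_ [x Dx <-]|x Dx] /=.
  by rewrite scalerA mulVf ?gt_eqF// scale1r.
by exists (r^-1 *: x)%R => //; rewrite scalerA mulfV ?gt_eqF// scale1r.
Qed.

Lemma measurable_dilation n (r : R) (D : set 'rV[R]_n) : (0 < r)%R ->
  measurable D -> measurable [set (r *: x)%R | x in D].
Proof.
move=> r0 mD; rewrite dilation_preimage// -[X in measurable X]setTI.
exact: measurable_rV_scale.
Qed.

(** The factor of [x |-> r^-1 *: x] is read off on the cube [0,1]^n, whose preimage is [0,r]^n. *)
Lemma lebesgue_rV_dilation n (r : R) (D : set 'rV[R]_n) : (0 < r)%R -> measurable D ->
  lebesgue_rV [set (r *: x)%R | x in D] = (r ^+ n)%:E * lebesgue_rV D.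
Proof.
move=> r0 mD.
have mT := @measurable_rV_scale n r^-1.
have mI a (i : 'I_n) : measurable (`[0%R, a]%classic : set R) by [].
have bE (a : R) : (0 < a)%R -> lebesgue_rV [set x : 'rV[R]_n |
    forall i, `[0%R, a]%classic (x ord0 i)] = (a ^+ n)%:E.
  move=> a0; rewrite (lebesgue_rV_box (mI a)).
  under eq_bigr do rewrite lebesgue_measure_itv/= lte_fin a0 oppr0 adde0.
  by rewrite prodEFin prodr_const card_ord.
have DE : \int[lebesgue_rV]_x (EFin \o \1_D) x = lebesgue_rV D.
  by rewrite integral_indic// setIT.
have := ge0_integral_lebesgue_rV_comp (g := EFin \o \1_D) mT _ _ _
  (measurable_rV_box (mI 1%R)).
rewrite bE// expr1n mule1 (_ : _ @^-1` _ =
    [set x : 'rV[R]_n | forall i, `[0%R, r]%classic (x ord0 i)]); last first.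
  apply/seteqP; split=> x /= h i; have := h i; rewrite !in_itv/= mxE.
    by rewrite mulrC pmulr_lge0 ?invr_gt0// ler_pdivrMr// mul1r.
  by rewrite mulrC pmulr_lge0 ?invr_gt0// ler_pdivrMr// mul1r.
rewrite bE// DE => <-; last first.
- by move=> x; rewrite lee_fin.
- exact/measurable_EFinP.
- move=> y; exists (r *: y)%R => x.
  by rewrite scalerDr scalerA mulVf ?gt_eqF// scale1r.
rewrite dilation_preimage// -[_ @^-1` D]setIT -integral_indic//.
by rewrite -dilation_preimage//; exact: measurable_dilation.
Qed.

End lebesgue_rV_linear.

(** * Orthogonal matrices with a prescribed first row *)

Section orthogonal.
Context {R : realType}.

Lemma dotpC n (x y : 'rV[R]_n) : dotp x y = dotp y x.
Proof. by apply: eq_bigr => i _; rewrite mulrC. Qed.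

Lemma mul_rV_trC n (x y : 'rV[R]_n) : x *m y^T = (dotp x y)%:M.
Proof. by rewrite [LHS]mx11_scalar dotp_mx. Qed.

Lemma dotpBl n (x y z : 'rV[R]_n) : dotp (x - y) z = dotp x z - dotp y z.
Proof. by rewrite -sumrB; apply: eq_bigr => i _; rewrite !mxE mulrBl. Qed.

Lemma dotp_delta0 n (x : 'rV[R]_n.+1) : dotp (delta_mx 0 0) x = x 0 0.
Proof.
rewrite /dotp (bigD1 ord0)//= big1 => [|i i0]; first by rewrite mxE !eqxx mul1r addr0.
by rewrite mxE eqxx/= (negbTE i0) mul0r.
Qed.

(* The Householder reflection exchanging the first basis vector and theta. *)
Lemma orthogonal_with_row0 n (theta : 'rV[R]_n.+1) : dotp theta theta = 1 ->
  exists2 P : 'M[R]_n.+1, P *m P^T = 1%:M & row ord0 P = theta.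
Proof.
move=> th1; pose e : 'rV[R]_n.+1 := delta_mx 0 0; pose v := e - theta.
have [v0|v0] := eqVneq (dotp v v) 0.
  exists 1%:M; first by rewrite trmx1 mulmx1.
  rewrite row1 -/e; apply/eqP; rewrite -subr_eq0 -/v; apply/eqP/rowP => i.
  rewrite [RHS]mxE; apply/eqP; rewrite -sqrf_eq0; apply/eqP.
  move: v0 => /eqP; rewrite psumr_eq0 => [/allP/(_ i)|j _]; last by rewrite -expr2 sqr_ge0.
  by rewrite mem_index_enum => /(_ erefl)/eqP; rewrite expr2.
have e0 : e 0 0 = 1 by rewrite mxE !eqxx.
have ev : e *m v^T = (1 - theta 0 0)%:M.
  by rewrite mul_rV_trC dotp_delta0 -e0 !mxE.
have vvE : dotp v v = 2 * (1 - theta 0 0).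
  rewrite {1}/v dotpBl dotp_delta0 [dotp theta _]dotpC dotpBl dotp_delta0 th1.
  by rewrite !mxE !eqxx/=; ring.
have vE : v = e - theta by [].
clearbody v; exists (1%:M - (2 / dotp v v) *: (v^T *m v)).
  rewrite (_ : (1%:M - _)^T = 1%:M - (2 / dotp v v) *: (v^T *m v)); last first.
    apply/matrixP => i j; rewrite !mxE eq_sym; congr (_ - _ * _).
    by apply: eq_bigr => k _; rewrite !mxE mulrC.
  rewrite mulmxBl mul1mx mulmxBr mulmx1 -scalemxAl -scalemxAr.
  rewrite mulmxA -(mulmxA v^T) mul_rV_trC mul_mx_scalar -scalemxAl !scalerA.
  rewrite divfK// mulr_natr mulr2n scalerDl; set w := _ *: _.
  by rewrite opprB addrK subrK.
rewrite rowE -/e mulmxBr mulmx1 -scalemxAr mulmxA ev mul_scalar_mx scalerA.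
(* As [e] and [theta] are unit vectors, (v,v) = 2 (e,v); the reflection therefore sends [e] to
   [e - v], which is [theta]. *)
rewrite vvE (_ : 2 / _ * _ = 1).
  by rewrite scale1r vE opprB addrC subrK.
have : 1 - theta 0 0 != 0 by apply: contraNneq v0; rewrite vvE => ->; rewrite mulr0.
by move=> h; field.
Qed.

End orthogonal.

(** * Integration over hyperplanes *)

Section hyperplane.
Context {R : realType}.

Lemma cons_rV_mul n (t : R) (y : 'rV[R]_n) (P : 'M[R]_n.+1) :
  cons_rV (t, y) *m P = t *: row ord0 P + y *m row' ord0 P.
Proof.
apply/rowP => j; rewrite !mxE big_ord_recl cons_rV_ord0; congr (_ + _).
by apply: eq_bigr => i _; rewrite cons_rV_lift !mxE.
Qed.

Lemma dotp_cons_rV_orthogonal n (t : R) (y : 'rV[R]_n) (P : 'M[R]_n.+1) :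
  P *m P^T = 1%:M -> dotp (cons_rV (t, y) *m P) (row ord0 P) = t.
Proof.
move=> PP; rewrite rowE dotp_mx trmx_mul mulmxA -(mulmxA _ P) PP mulmx1 -dotp_mx.
by rewrite dotpC dotp_delta0 cons_rV_ord0.
Qed.

(** The rows of [P] after the first form an orthonormal basis of the directions of the hyperplane,
    and [t] times the first row is a point of it. Fixing the first coordinate before multiplying by
    [P] thus parametrizes a hyperplane isometrically. *)
Lemma isometric_chart_row' n (t : R) (P : 'M[R]_n.+1) : P *m P^T = 1%:M ->
  @isometric_chart R n.+1 [set x | dotp x (row ord0 P) = t]
    (t *: row ord0 P, row' ord0 P).
Proof.
move=> PP; split => /=.
  apply/matrixP => i j; have /matrixP/(_ (lift ord0 i) (lift ord0 j)) := PP.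
  rewrite !mxE (inj_eq lift_inj) => <-.
  by apply: eq_bigr => k _; rewrite !mxE.
apply/seteqP; split=> [_ [y _ <-]|x /= xt].
  by rewrite /affine_map/= -cons_rV_mul dotp_cons_rV_orthogonal.
have [s [y sy]] := cons_rV_surj (x *m P^T).
have xE : x = cons_rV (s, y) *m P by rewrite -sy -mulmxA (mulmx1C PP) mulmx1.
exists y => //; rewrite /affine_map/= -xt xE dotp_cons_rV_orthogonal//.
by rewrite -cons_rV_mul.
Qed.

Local Open Scope ereal_scope.

(** The charts differ by [y |-> y *m (B' *m B^T) + y0], where [B' *m B^T] is orthogonal and [y0] is
    the parameter of the base point of the second chart in the first one. *)
Lemma isometric_chart_integral n (H : set 'rV[R]_n) c c' (F : 'rV[R]_n -> \bar R) :
  isometric_chart H c -> isometric_chart H c' ->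
  measurable_fun setT F -> (forall x, 0 <= F x) ->
  \int[lebesgue_rV]_y F (affine_map c' y) = \int[lebesgue_rV]_y F (affine_map c y).
Proof.
case: c c' => [a B] [a' B'] [/= BB rB] [/= BB' rB'] mF F0.
have inH y : exists z, (a' + y *m B' = a + z *m B)%R.
  have : range (affine_map (a, B)) (a' + y *m B')%R by rewrite rB -rB'; exists y.
  by move=> [z _ <-]; exists z.
have [y0 a'E] : exists z, (a' = a + z *m B)%R.
  by have [z] := inH 0%R; rewrite mul0mx addr0; exists z.
(* Equal ranges put every row of [B'] in the row space of [B], on which [B^T *m B] acts as the
   identity. *)
have B'E : (B' *m B^T *m B = B')%R.
  apply/row_matrixP => i; have [z] := inH (delta_mx ord0 i).
  rewrite a'E -addrA => /addrI; rewrite -rowE => zE0.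
  have zE : row i B' = ((z - y0) *m B)%R by rewrite mulmxBl -zE0 addrAC subrr add0r.
  by rewrite !row_mul zE -(mulmxA _ B) BB mulmx1.
have PP : (B' *m B^T *m (B' *m B^T)^T = 1%:M)%R.
  by rewrite trmx_mul trmxK mulmxA B'E.
pose G (z : 'rV[R]_n.-1) := F (affine_map (a, B) z).
have mG : measurable_fun setT G by apply: (measurableT_comp mF); exact: measurable_affine_map.
transitivity (\int[lebesgue_rV]_y G (y *m (B' *m B^T) + y0)%R).
  apply: eq_integral => y _; rewrite /G /affine_map/= a'E; congr (F _).
  by rewrite mulmxDl -mulmxA B'E addrAC -!addrA.
have mGy0 : measurable_fun setT (fun z : 'rV[R]_n.-1 => G (z + y0)%R).
  by apply: (measurableT_comp mG); exact: measurable_rV_addr.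
rewrite (ge0_integral_lebesgue_rV_orthogonal PP mGy0 (fun=> F0 _)).
exact: (ge0_integral_lebesgue_rV_shift y0 mG (fun=> F0 _)).
Qed.

(** This trades the chart chosen by [get] for an explicit one; the existence of [c] ensures that
    [get] returns a true chart and not a default value. *)
Lemma integral_hyperplane n (H : set 'rV[R]_n) c (F : 'rV[R]_n -> \bar R) :
  isometric_chart H c -> measurable H ->
  measurable_fun setT F -> (forall x, 0 <= F x) ->
  \int[hyperplane_measure H]_(x in H) F x = \int[lebesgue_rV]_y F (affine_map c y).
Proof.
move=> Hc mH mF F0; have Hg : isometric_chart H (get (isometric_chart H)).
  by apply: (getPex (P := isometric_chart H)); exists c.
rewrite -(isometric_chart_integral Hc Hg mF F0).
have H0 : {in H, forall y, 0 <= F y} by [].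
apply: (etrans (ge0_integral_pushforward (@measurable_affine_map R n _)
   lebesgue_rV mH (measurable_funS measurableT (@subsetT _ _) mF) H0)).
rewrite (_ : _ @^-1` H = setT)//; apply/seteqP; split=> // y _.
have [_ Hr] := Hg.
have : range (affine_map (get (isometric_chart H)))
  (affine_map (get (isometric_chart H)) y) by exists y.
by rewrite Hr.
Qed.

Lemma measurable_hyperplane n (theta : 'rV[R]_n) (t : R) :
  measurable [set x | dotp x theta = t].
Proof.
rewrite [X in measurable X](_ : _ = (fun x : 'rV[R]_n => dotp x theta) @^-1` [set t])//.
by rewrite -[X in measurable X]setTI; exact: measurable_dotp.
Qed.

(** An orthogonal change of variables whose first row is [theta] turns the slab into the set where
    the first coordinate [t] satisfies |t| <= a. The inner integral at each such [t] is an integral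
    over one hyperplane. *)
Lemma integral_slab n (theta : 'rV[R]_n) (F : 'rV[R]_n -> \bar R) (a : R) (M : \bar R) :
  dotp theta theta = 1%R -> (0 <= a)%R ->
  measurable_fun setT F -> (forall x, 0 <= F x) -> 0 <= M ->
  (forall t, \int[hyperplane_measure [set x | dotp x theta = t]]_(x in
     [set x | dotp x theta = t]) F x <= M) ->
  \int[lebesgue_rV]_(x in [set x | `|dotp x theta| <= a]%R) F x <= (2 * a)%:E * M.
Proof.
case: n theta F => [|n] theta F th1.
  by move: th1; rewrite /dotp big_ord0 => /eqP; rewrite eq_sym oner_eq0.
move=> a0 mF F0 M0 FM; have [P PP Pth] := orthogonal_with_row0 th1.
set S := [set x | _]; have mS : measurable S.
  rewrite [X in measurable X](_ : _ = (fun x : 'rV[R]_n.+1 => `|dotp x theta|)%R @^-1` `]-oo, a]).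
    rewrite -[X in measurable X]setTI.
    have : measurable_fun setT (fun x : 'rV[R]_n.+1 => `|dotp x theta|)%R.
      by apply: measurableT_comp => //; exact: measurable_dotp.
    exact.
  by apply/seteqP; split=> x; rewrite /S/= in_itv.
have mI : measurable (`[(- a)%R, a]%classic : set R) by [].
have mFS : measurable_fun setT (F \_ S) by apply/(measurable_restrictT _ mS); exact: measurable_funTS.
have FS0 x : 0 <= (F \_ S) x by rewrite /patch; case: ifP.
rewrite integral_mkcond.
rewrite -(ge0_integral_lebesgue_rV_orthogonal PP)// ge0_integral_lebesgue_rVS//; last first.
  by apply: (measurableT_comp mFS); exact: measurable_mulmx.
apply: (@le_trans _ _ (\int[lebesgue_measure]_(t in `[(- a)%R, a]) M)); last first.
  rewrite integral_cst//= lebesgue_measure_itv/= lte_fin muleC.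
  case: ifPn => [_|]; last by rewrite mul0e mule_ge0 ?lee_fin ?mulr_ge0.
  by rewrite -EFinD opprK mulr_natl mulr2n.
rewrite [leRHS]integral_mkcond; apply: ge0_le_integral => //.
- by move=> t _; exact: integral_ge0.
- apply: (measurable_fun_integral_cons_rV (f := fun x => (F \_ S) (x *m P)%R)) => //.
  by apply: (measurableT_comp mFS); exact: measurable_mulmx.
- by apply/(measurable_restrictT _ mI).
move=> t _; rewrite /patch.
under eq_integral.
  move=> y _; rewrite (_ : _ \in S = (t \in `[(- a)%R, a]%classic)).
    over.
  apply/idP/idP; rewrite !inE /S/= -Pth dotp_cons_rV_orthogonal// in_itv/= ler_norml//.
case: ifP => tI; last by rewrite integral0.
apply: le_trans (FM t); rewrite -Pth.
rewrite (integral_hyperplane (isometric_chart_row' t PP) (measurable_hyperplane _ _) mF F0).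
by under eq_integral do rewrite cons_rV_mul.
Qed.

End hyperplane.

(** * Moments of linear forms on the cube *)

Section cube_moments.
Context {R : realType}.

(** If y^2 >= 1/4, then |y| <= 2 y^2. Otherwise exp(z) (1 - z) <= 1 at z = y and z = -y bounds the
    sum by 2 / (1 - y^2), and (1 + 2 y^2) (1 - y^2) >= 1. *)
Lemma expR_addN_le (y : R) : expR y + expR (- y) <= 2 * expR (2 * y ^+ 2).
Proof.
have [y2|y2] := leP (1 / 4) (y ^+ 2).
  have h (z : R) : z ^+ 2 = y ^+ 2 -> expR z <= expR (2 * y ^+ 2).
    by move=> zy; rewrite ler_expR -zy; rewrite -zy in y2; nra.
  have := h y erefl; have := h (- y); rewrite sqrrN => /(_ erefl); lra.
have h (z : R) : z ^+ 2 = y ^+ 2 -> expR z * (1 - z) <= 1.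
  move=> zy; rewrite -[leRHS](expR0) -(subrr z) expRD ler_pM2l ?expR_gt0//.
  exact: expR_ge1Dx.
have h1 := h y erefl; have := h (- y); rewrite sqrrN opprK => /(_ erefl) h2.
have h3 := expR_ge1Dx (2 * y ^+ 2).
have y1 : 0 < 1 - y by nra.
have y1' : 0 < 1 + y by nra.
have h4 : (expR y + expR (- y)) * ((1 - y) * (1 + y)) <= 2 by nra.
have h5 : 2 <= (2 * expR (2 * y ^+ 2)) * ((1 - y) * (1 + y)) by nra.
by rewrite -(ler_pM2r (mulr_gt0 y1 y1')); exact: le_trans h5.
Qed.

Local Open Scope ereal_scope.

Lemma ge0_integral_lebesgue_opp (f : R -> \bar R) :
  measurable_fun setT f -> (forall x, 0 <= f x) ->
  \int[lebesgue_measure]_x f (- x)%R = \int[lebesgue_measure]_x f x.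
Proof.
move=> mf f0.
have mN : measurable_fun setT (-%R : measurableTypeR R -> measurableTypeR R) by [].
transitivity (\int[pushforward lebesgue_measure
    (-%R : measurableTypeR R -> measurableTypeR R)]_x f x).
  by rewrite (ge0_integral_pushforward mN).
by apply: eq_measure_integral => A mA _; exact: lebesgue_measureN.
Qed.

Definition interval_half : set R := `[(- (1 / 2))%R, (1 / 2)%R]%classic.

Lemma measurable_interval_half : measurable interval_half.
Proof. exact: measurable_itv. Qed.
Local Hint Resolve measurable_interval_half : core.

(** Averaging with the reflected integrand replaces exp(a t) by cosh(a t), which is at most exp(2
    a^2 t^2); then |t| <= 1/2 gives the exponent a^2 / 2. *)
Lemma integral_half_expR_le (a : R) :
  \int[lebesgue_measure]_t (expR (a * t) * \1_interval_half t)%:E <= (expR (a ^+ 2 / 2))%:E.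
Proof.
have mI := measurable_interval_half.
pose f b (t : R) := (expR (b * t) * \1_interval_half t)%:E.
have mf b : measurable_fun setT (f b).
  apply/measurable_EFinP; apply: measurable_funM => //.
  by apply: measurableT_comp => //; exact: measurable_funM.
have f0 b t : 0 <= f b t by rewrite lee_fin mulr_ge0// expR_ge0.
have fN : \int[lebesgue_measure]_t f (- a)%R t = \int[lebesgue_measure]_t f a t.
  rewrite -[RHS]ge0_integral_lebesgue_opp//; apply: eq_integral => t _.
  have tN : ((- t)%R \in interval_half) = (t \in interval_half).
    rewrite /interval_half; apply/idP/idP; rewrite !inE/= !in_itv/=;
      by move=> /andP[? ?]; apply/andP; split; lra.
  by rewrite /f mulrN mulNr !indicE tN.
have : 2%:E * \int[lebesgue_measure]_t f a t <= 2%:E * (expR (a ^+ 2 / 2))%:E.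
  rewrite mule_natl mule2n -[X in _ + X]fN.
  rewrite -ge0_integralD//; [|exact: (mf a)|exact: (mf (- a)%R)].
  apply: (@le_trans _ _ (\int[lebesgue_measure]_(t in interval_half) (2 * expR (a ^+ 2 / 2))%:E)); last first.
    rewrite integral_cst//= lebesgue_measure_itv/= lte_fin ifT; last by lra.
    rewrite -EFinD -!EFinM lee_fin; have := expR_ge0 (a ^+ 2 / 2); lra.
  rewrite [leRHS]integral_mkcond; apply: ge0_le_integral => //.
  - by move=> t _; exact: adde_ge0.
  - exact: (emeasurable_funD (mf a) (mf (- a)%R)).
  - by apply/(measurable_restrictT _ mI).
  move=> t _; rewrite /patch /f indicE; case: ifPn => [|_]; last by rewrite !mulr0 adde0.
  rewrite inE /interval_half/= in_itv/= => /andP[t1 t2].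
  rewrite !mulr1 -EFinD lee_fin mulNr (le_trans (expR_addN_le _))// ler_pM2l// ler_expR exprMn.
  have t4 : (0 <= 1 / 4 - t ^+ 2)%R by nra.
  by have := mulr_ge0 (sqr_ge0 a) t4; lra.
have c2 : (0 : \bar R) < 2%:E by rewrite lte_fin.
by rewrite (@lee_pmul2l R 2%:E isT c2).
Qed.

Definition cube n := [set x : 'rV[R]_n | forall i, interval_half (x ord0 i)].

Lemma measurable_cube n : measurable (@cube n).
Proof.
exact: (measurable_rV_box (fun i : 'I_n => measurable_interval_half)).
Qed.

Lemma lebesgue_rV_cube n : lebesgue_rV (@cube n) = 1.
Proof.
rewrite (lebesgue_rV_box (fun i : 'I_n => measurable_interval_half)).
rewrite big1// => i _; rewrite lebesgue_measure_itv/= lte_fin ifT; last by lra.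
by rewrite -EFinD; congr _%:E; lra.
Qed.

(** The integrand is a product over the coordinates, so the one-dimensional bounds multiply and
    their exponents add up to half of (theta,theta). *)
Lemma integral_cube_expR_le n (theta : 'rV[R]_n) :
  \int[lebesgue_rV]_x (expR (dotp x theta) * \1_(@cube n) x)%:E
  <= (expR (dotp theta theta / 2))%:E.
Proof.
have mG m (th : 'rV[R]_m) : measurable_fun setT
    (fun x : 'rV[R]_m => (expR (dotp x th) * \1_(@cube m) x)%:E).
  apply/measurable_EFinP; apply: measurable_funM.
    by apply: measurableT_comp => //; exact: measurable_dotp.
  by apply: measurable_indic; exact: measurable_cube.
have G0 m (th : 'rV[R]_m) x : 0 <= (expR (dotp x th) * \1_(@cube m) x)%:E.
  by rewrite lee_fin mulr_ge0// expR_ge0.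
elim: n theta => [|n IH] theta.
  rewrite /= integral_dirac//; last exact: (mG 0%N).
  rewrite [X in X * _](_ : _ = 1); last exact: diracT.
  rewrite mul1e lee_fin /dotp !big_ord0.
  by rewrite mul0r expR0 mul1r indicE; case: (_ \in _).
rewrite ge0_integral_lebesgue_rVS//.
have [s [th ->]] := cons_rV_surj theta.
have dE (t u : R) (y z : 'rV[R]_n) :
    (dotp (cons_rV (t, y)) (cons_rV (u, z)) = t * u + dotp y z)%R.
  rewrite /dotp big_ord_recl !cons_rV_ord0; congr (_ + _)%R.
  by apply: eq_bigr => i _; rewrite !cons_rV_lift.
have mE : measurable_fun setT (fun t : R => (expR (s * t) * \1_interval_half t)%:E).
  apply/measurable_EFinP; apply: measurable_funM.
    by apply: measurableT_comp => //; exact: measurable_funM.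
  by apply: measurable_indic; exact: measurable_interval_half.
have E0 (t : R) : 0 <= (expR (s * t) * \1_interval_half t)%:E.
  by rewrite lee_fin mulr_ge0// expR_ge0.
rewrite dE mulrDl expRD EFinM.
apply: (@le_trans _ _ (\int[lebesgue_measure]_t ((expR (s * t) * \1_interval_half t)%:E *
    (expR (dotp th th / 2))%:E))).
  apply: ge0_le_integral => //.
  - by move=> t _; exact: integral_ge0.
  - exact: measurable_fun_integral_cons_rV (mG _ _) (G0 _ _).
  - exact: (emeasurable_funM mE (measurable_cst _)).
  move=> t _; apply: (@le_trans _ _ ((expR (s * t) * \1_interval_half t)%:E *
      \int[lebesgue_rV]_y (expR (dotp y th) * \1_(@cube n) y)%:E)); last first.
    by apply: lee_pmul => //; rewrite ?lee_fin ?mulr_ge0 ?expR_ge0//; exact: integral_ge0.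
  rewrite -ge0_integralZl ?lee_fin ?mulr_ge0 ?expR_ge0//.
  apply: ge0_le_integral => //.
  + exact: (measurable_fun_cons_rV _ (mG _ _)).
  + exact: (emeasurable_funM (measurable_cst _) (mG _ _)).
  move=> y _; rewrite dE expRD [(t * s)%R]mulrC lee_fin !indicE.
  have -> : (cons_rV (t, y) \in @cube n.+1) = (t \in interval_half) && (y \in @cube n).
    apply/idP/idP; rewrite !inE.
      move=> h; apply/andP; split; rewrite inE.
        by have := h ord0; rewrite cons_rV_ord0.
      by move=> i; have := h (lift ord0 i); rewrite cons_rV_lift.
    move=> /andP[]; rewrite !inE => tI yQ i.
    by case: (unliftP ord0 i) => [j|] ->; rewrite ?cons_rV_lift ?cons_rV_ord0//; exact: yQ.
  by case: (t \in _); case: (y \in _); rewrite /= ?mulr1 ?mulr0 ?mul0r.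
rewrite ge0_integralZr ?lee_fin ?expR_ge0//.
apply: lee_wpmul2r; first by rewrite lee_fin expR_ge0.
by rewrite -expr2; exact: integral_half_expR_le.
Qed.

Lemma powR_le_expR (w p : R) : (0 <= w)%R -> (0 < p)%R -> (w `^ p <= expR (p * (w - 1)))%R.
Proof.
move=> w0 p0; have [->|wn0] := eqVneq w 0%R; first by rewrite powR0 ?gt_eqF// expR_ge0.
rewrite /powR (negbTE wn0) ler_expR ler_pM2l//.
have wp : (0 < w)%R by rewrite lt_def wn0.
by rewrite -ler_expR lnK ?posrE//; have := expR_ge1Dx (w - 1); rewrite addrC subrK.
Qed.

Lemma measurable_normr_powR (p : R) : measurable_fun setT (fun u : R => `|u| `^ p)%R.
Proof. by apply: (measurableT_comp (measurable_powR p)); exact: normr_measurable. Qed.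

(** The exponential moment is used at the parameter [s], the square root of [p]: the terms exp(s u)
    and exp(-s u) have mean at most exp(p/2) each, and the prefactor exp(-p) absorbs this, leaving
    the factor 2. *)
Lemma integral_cube_powR_le n (theta : 'rV[R]_n) (p : R) :
  (0 < p)%R -> dotp theta theta = 1%R ->
  \int[lebesgue_rV]_x (`|dotp x theta| `^ p * \1_(@cube n) x)%:E
  <= (2 * Num.sqrt p `^ p)%:E.
Proof.
move=> p0 th1; set s := Num.sqrt p.
have s0 : (0 < s)%R by rewrite sqrtr_gt0.
have ss : (s * s = p)%R by rewrite -expr2 sqr_sqrtr// ltW.
have dZ (x : 'rV[R]_n) (c : R) : (dotp x (c *: theta) = c * dotp x theta)%R.
  by rewrite /dotp mulr_sumr; apply: eq_bigr => i _; rewrite mxE mulrCA.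
(* (|u| / s) ^ p <= exp (s |u| - p), because p = s ^ 2. *)
have ptw (u : R) : (`|u| `^ p <= s `^ p * expR (- p) * (expR (s * u) + expR (- s * u)))%R.
  have -> : (`|u| = s * (`|u| / s))%R by rewrite mulrC divfK// gt_eqF.
  have us0 : (0 <= `|u| / s)%R by rewrite divr_ge0// ltW.
  rewrite (powRM _ (ltW s0) us0) -mulrA ler_pM2l ?powR_gt0//.
  apply: (le_trans (powR_le_expR us0 p0)).
  rewrite mulrBr mulr1 addrC expRD ler_pM2l ?expR_gt0//.
  rewrite (_ : p * (`|u| / s) = s * `|u|)%R; last first.
    by rewrite -ss; field; rewrite gt_eqF.
  rewrite mulNr.
  have e1 := expR_ge0 (s * u); have e2 := expR_ge0 (- (s * u)).
  by case: (ger0P u) => _; rewrite ?mulrN; lra.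
pose G (c : R) (x : 'rV[R]_n) := (expR (dotp x (c *: theta)) * \1_(@cube n) x)%:E.
have mG c : measurable_fun setT (G c).
  apply/measurable_EFinP; apply: measurable_funM.
    by apply: measurableT_comp => //; exact: measurable_dotp.
  by apply: measurable_indic; exact: measurable_cube.
have G0 c x : 0 <= G c x by rewrite lee_fin mulr_ge0// expR_ge0.
have GI c : (c ^+ 2 = p)%R -> \int[lebesgue_rV]_x G c x <= (expR (p / 2))%:E.
  move=> cp; apply: (le_trans (integral_cube_expR_le _)).
  by rewrite dZ [dotp _ theta]dotpC dZ th1 mulr1 -expr2 cp.
have c0 : (0 <= s `^ p * expR (- p))%R by rewrite mulr_ge0 ?powR_ge0 ?expR_ge0.
apply: (@le_trans _ _ (\int[lebesgue_rV]_x ((s `^ p * expR (- p))%:E * (G s x + G (- s)%R x)))).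
  apply: ge0_le_integral => //.
  - apply/measurable_EFinP; apply: measurable_funM.
      apply: (measurableT_comp (measurable_normr_powR p)).
      exact: measurable_dotp.
    by apply: measurable_indic; exact: measurable_cube.
  - by apply: emeasurable_funM => //; exact: emeasurable_funD.
  move=> x _; rewrite /G !dZ -EFinD -EFinM lee_fin -mulrDl mulrA.
  by apply: ler_wpM2r.
rewrite ge0_integralZl//; last 2 first.
- exact: emeasurable_funD.
- by move=> x _; exact: adde_ge0.
rewrite ge0_integralD//.
apply: (@le_trans _ _ ((s `^ p * expR (- p))%:E * (expR (p / 2) + expR (p / 2))%:E)).
  apply: lee_wpmul2l; first by rewrite lee_fin.
  by rewrite EFinD leeD// GI ?sqrrN ?expr2.
rewrite -EFinM lee_fin -mulr2n -[X in (_ * X)%R]mulr_natl.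
rewrite mulrCA ler_pM2l// -mulrA -[leRHS]mulr1 ler_pM2l ?powR_gt0//.
rewrite -expRD -[leRHS]expR0 ler_expR; lra.
Qed.

End cube_moments.

(** * Unit balls of subspaces of L_p *)

Section symmetric_convex_body.
Context {R : realType} (n : nat).
Implicit Type D : set 'rV[R]_n.

Lemma convex_set_comb D (x y : 'rV[R]_n) (t : R) : convex_set D ->
  D x -> D y -> 0 <= t -> t <= 1 -> D (t *: x + (1 - t) *: y).
Proof.
move=> cD Dx Dy t0 t1.
by have := cD x y (Itv01 t0 t1); rewrite !inE; apply.
Qed.

(** For small [d], the point [d *: x] is the midpoint of [z + (2 * d) *: x], still in the ball
    around the interior point [z], and of [- z], supplied by symmetry. *)
Lemma symmetric_convex_body_absorbing D (x : 'rV[R]_n) :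
  convex_body D -> centrally_symmetric D -> exists2 d : R, 0 < d & D (d *: x).
Proof.
move=> [_ cD [z /nbhs_ballP[e /= e0 eD]]] sD.
pose d := e / (4 * (`|x| + 1)).
have x1 : 0 < `|x| + 1 by rewrite ltr_wpDl.
have d0 : 0 < d by rewrite divr_gt0// mulr_gt0.
exists d => //.
have -> : d *: x = 2^-1 *: (z + (2 * d) *: x) + (1 - 2^-1) *: (- z).
  have h2 : 1 - 2^-1 = 2^-1 :> R by lra.
  by rewrite h2 scalerDr scalerN scalerA mulrA mulVf// mul1r addrAC subrr add0r.
have Dz : D z by apply: eD; exact: ballxx.
have DNz : D (- z) by rewrite sD; exists z.
apply: convex_set_comb => //; [|lra].
apply: eD; rewrite -ball_normE/= opprD addrA subrr add0r normrN normrZ.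
rewrite ger0_norm; last by rewrite mulr_ge0// ltW.
rewrite /d; have -> : 2 * (e / (4 * (`|x| + 1))) * `|x| = (e / 2) * (`|x| / (`|x| + 1)).
  by field; rewrite gt_eqF.
have : `|x| / (`|x| + 1) <= 1 by rewrite ler_pdivrMr// mul1r lerDl.
nra.
Qed.

Lemma minkowski_functional_itv D (x : 'rV[R]_n) : D x ->
  0 <= minkowski_functional D x <= 1.
Proof.
move=> Dx; have x1 : [set a : R | 0 <= a /\ [set a *: y | y in D] x] 1.
  by split => //; exists x => //; rewrite scale1r.
apply/andP; split; first by apply: lb_le_inf; [exists 1|move=> a []].
by apply: ge_inf => //; exists 0 => a [].
Qed.

(** Absorption makes the set under the infimum non-empty, so some [a < r] has [x] in a D. As D is
    convex and contains 0, a D lies in r D. *)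
Lemma minkowski_functional_lt D (x : 'rV[R]_n) (r : R) :
  convex_body D -> centrally_symmetric D ->
  minkowski_functional D x < r -> [set r *: y | y in D] x.
Proof.
move=> bD sD xr.
have [d d0 Dd] := symmetric_convex_body_absorbing x bD sD.
have xE : [set a : R | 0 <= a /\ [set a *: y | y in D] x] !=set0.
  exists d^-1; split; first by rewrite invr_ge0 ltW.
  by exists (d *: x) => //; rewrite scalerA mulVf ?gt_eqF// scale1r.
have [a [a0 [y Dy <-]] ar] := inf_lt xE xr.
have r0 : 0 < r by exact: le_lt_trans ar.
have [d' _] := symmetric_convex_body_absorbing 0 bD sD; rewrite scaler0 => D0.
have [_ cD _] := bD.
exists (a / r *: y); last by rewrite scalerA mulrC divfK// gt_eqF.
have := convex_set_comb (t := a / r) cD Dy D0; rewrite scaler0 addr0; apply.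
  by rewrite divr_ge0// ltW.
by rewrite ler_pdivrMr// mul1r ltW.
Qed.

Lemma measurable_compact_rV (K : set 'rV[R]_n) : compact K -> measurable K.
Proof.
move=> cK; rewrite -[K]setCK; apply: measurableC; apply: open_measurable_rV.
by apply: closed_openC; apply: compact_closed => //; exact: norm_hausdorff.
Qed.

End symmetric_convex_body.

Section compact_coord.
Context {R : realType}.

Lemma compact_coord_bounded n (K : set 'rV[R]_n) : compact K ->
  exists2 M : R, 0 <= M & forall x, K x -> forall i, `|x ord0 i| <= M.
Proof.
case: n K => [|n] K cK; first by exists 0 => // x _ [].
have [N [_ KN]] := compact_bounded cK.
exists (`|N| + 1); first by rewrite addr_ge0.
move=> x Kx i; apply: (@le_trans _ _ `|x|); last first.
  by apply: KN => //; rewrite ltr_pwDr// ler_norm.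
by rewrite [leRHS]/Num.Def.normr /= mx_normrE; apply/bigmax_geP; right => /=; exists (ord0, i).
Qed.

Lemma lebesgue_rV_compact_fin n (K : set 'rV[R]_n) : compact K ->
  lebesgue_rV K \is a fin_num.
Proof.
move=> cK; have mK := measurable_compact_rV cK.
have [M _ KM] := compact_coord_bounded cK.
by rewrite ge0_fin_numE//; exact: lebesgue_rV_bounded_lty KM.
Qed.

End compact_coord.

(** * Averages of |(x, theta)|^p over the sphere *)

Section Lp_ball_estimates.
Context {R : realType}.
Local Open Scope ereal_scope.

Lemma unit_sphere_dotp n (x : 'rV[R]_n) : unit_sphere x <-> dotp x x = 1%R.
Proof.
have x0 : (0 <= dotp x x)%R by apply: sumr_ge0 => i _; rewrite -expr2 sqr_ge0.
split=> [h|xx]; last by rewrite /unit_sphere/= /enorm xx sqrtr1.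
by rewrite -(sqr_sqrtr x0) (h : Num.sqrt _ = 1%R) expr1n.
Qed.

Section average.
Variables (n : nat) (p : R) (nu : {finite_measure set 'rV[R]_n -> \bar R}).
Let S := @unit_sphere R n.

Lemma measurable_unit_sphere : measurable S.
Proof.
rewrite [X in measurable X](_ : _ = [set x : 'rV[R]_n | dotp x x = 1%R]).
  rewrite [X in measurable X](_ : _ = (fun x : 'rV[R]_n => dotp x x) @^-1` [set 1%R])//.
  by rewrite -[X in measurable X]setTI; exact: measurable_dotp.
by apply/seteqP; split=> x; move/unit_sphere_dotp.
Qed.

(** The indicator of the sphere sits inside the integrand so that Tonelli applies on the full
    product space. The weight [g] will be the indicator of the cube in the volume bound and the
    extended density in the slab bound. *)
Let H (g : 'rV[R]_n -> \bar R) (z : 'rV[R]_n * 'rV[R]_n) :=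
  g z.1 * (`|dotp z.1 z.2| `^ p * \1_S z.2)%:E.

Let mH g : measurable_fun setT g -> measurable_fun setT (H g).
Proof.
move=> mg; apply: emeasurable_funM; first exact: measurableT_comp.
apply/measurable_EFinP; apply: measurable_funM.
  by apply: (measurableT_comp (measurable_normr_powR p)); exact: measurable_dotp.
have mS : measurable_fun setT (\1_S : 'rV[R]_n -> R).
  by apply: measurable_indic; exact: measurable_unit_sphere.
exact: (measurableT_comp mS measurable_snd).
Qed.

Let H0 g : (forall x, 0 <= g x) -> forall z, 0 <= H g z.
Proof. by move=> g0 z; rewrite mule_ge0// lee_fin mulr_ge0// powR_ge0. Qed.

Let integral_HE g x : (forall x, 0 <= g x) ->
  \int[nu]_y H g (x, y) = g x * \int[nu]_(theta in S) (`|dotp x theta| `^ p)%:E.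
Proof.
move=> g0; rewrite [in RHS]integral_mkcond -ge0_integralZl//.
- apply: eq_integral => y _; rewrite /H/= /patch indicE.
  by case: ifPn => _; rewrite ?mulr1 ?mulr0.
- apply/(measurable_restrictT _ measurable_unit_sphere); apply: measurable_funTS.
  apply/measurable_EFinP.
  by apply: (measurableT_comp (measurable_normr_powR p)); exact: measurable_dotp.
- by move=> y _; rewrite /patch; case: ifP => // _; rewrite lee_fin powR_ge0.
Qed.

Lemma ge0_integral_mul_average g :
  measurable_fun setT g -> (forall x, 0 <= g x) ->
  \int[lebesgue_rV]_x (g x * \int[nu]_(theta in S) (`|dotp x theta| `^ p)%:E) =
  \int[nu]_(theta in S) \int[lebesgue_rV]_x (g x * (`|dotp x theta| `^ p)%:E).
Proof.
move=> mg g0; under eq_integral do rewrite -integral_HE//.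
rewrite (@fubini_tonelli _ _ _ _ R (@lebesgue_rV R n) nu (H g) (mH mg) (H0 g0)).
rewrite [RHS]integral_mkcond; apply: eq_integral => y _.
rewrite /patch; case: ifP => yS.
  by apply: eq_integral => x _; rewrite /H /= indicE yS mulr1.
by rewrite integral0_eq// => x _; rewrite /H /= indicE yS mulr0 mule0.
Qed.

Lemma measurable_average :
  measurable_fun setT (fun x : 'rV[R]_n => \int[nu]_(theta in S) (`|dotp x theta| `^ p)%:E).
Proof.
have m1 : measurable_fun setT (fun _ : 'rV[R]_n => 1 : \bar R) by [].
have := @measurable_fun_fubini_tonelli_F _ _ _ _ R nu _ (mH m1) (H0 (fun=> lee01)).
by apply: eq_measurable_fun => x _; rewrite /fubini_F integral_HE// mul1e.
Qed.

Lemma measurable_average_dual g :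
  measurable_fun setT g -> (forall x, 0 <= g x) ->
  measurable_fun S (fun theta => \int[lebesgue_rV]_x (g x * (`|dotp x theta| `^ p)%:E)).
Proof.
move=> mg g0.
have := @measurable_fun_fubini_tonelli_G _ _ _ _ R (@lebesgue_rV R n) _ (mH mg) (H0 g0).
move=> /(measurable_funS measurableT (@subsetT _ S)); apply: eq_measurable_fun => y yS.
by apply: eq_integral => x _; rewrite /H/= indicE yS mulr1.
Qed.

End average.
End Lp_ball_estimates.

(** * Volume and mass estimates from the representing measure *)

Section Lp_ball_bounds.
Context {R : realType}.
Local Open Scope ereal_scope.

(* Markov's inequality on the unit cube Q, where the mean of ||x||_D ^ p is at
   most 2 nu(S) (sqrt p) ^ p: half of Q lies in r D. *)
Lemma Lp_ball_volume_ge n (D : set 'rV[R]_n) (p r : R)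
    (nu : {finite_measure set 'rV[R]_n -> \bar R}) :
  convex_body D -> centrally_symmetric D ->
  (forall x, (minkowski_functional D x `^ p)%:E =
    \int[nu]_(theta in @unit_sphere R n) (`|dotp x theta| `^ p)%:E) ->
  (0 < p)%R -> (0 < r)%R ->
  (4 * fine (nu (@unit_sphere R n)) * Num.sqrt p `^ p <= r `^ p)%R ->
  (2^-1)%:E <= (r ^+ n)%:E * lebesgue_rV D.
Proof.
move=> bD sD NE p0 r0 rp.
set S := @unit_sphere R n in NE rp *; set s := Num.sqrt p in rp.
have mS : measurable S by exact: measurable_unit_sphere.
have nuf : nu S \is a fin_num by exact: fin_num_measure.
have mD : measurable D by apply: measurable_compact_rV; case: bD.
pose rD := [set (r *: y)%R | y in D].
have mrD : measurable rD by exact: measurable_dilation.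
pose Q := @cube R n; have mQ : measurable Q by exact: measurable_cube.
pose g : 'rV[R]_n -> \bar R := fun x => (\1_Q x)%:E.
have mg : measurable_fun setT g by apply/measurable_EFinP; exact: measurable_indic.
have g0 x : 0 <= g x by rewrite lee_fin.
pose Phi := fun x : 'rV[R]_n => \int[nu]_(theta in S) (`|dotp x theta| `^ p)%:E.
have mPhi : measurable_fun setT Phi by exact: measurable_average.
have Phi0 x : 0 <= Phi x by apply: integral_ge0 => y _; rewrite lee_fin powR_ge0.
have IQ : \int[lebesgue_rV]_x (g x * Phi x) <= (r `^ p / 2)%:E.
  rewrite ge0_integral_mul_average//.
  apply: (@le_trans _ _ (\int[nu]_(theta in S) (2 * s `^ p)%:E)).
    apply: ge0_le_integral => //.
    - by move=> y _; apply: integral_ge0 => x _; rewrite mule_ge0// lee_fin powR_ge0.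
    - exact: measurable_average_dual.
    move=> y /unit_sphere_dotp y1; apply: le_trans (integral_cube_powR_le p0 y1).
    by under eq_integral do rewrite /g -EFinM mulrC.
  rewrite integral_cst//= -(fineK nuf) -EFinM lee_fin.
  by move: rp; lra.
have rp0 : (0 < r `^ p)%R by rewrite powR_gt0.
(* A point of the cube either lies in r D or has norm at least [r], and then its term in the
   integral is at least 1. *)
have : lebesgue_rV Q <= lebesgue_rV rD + ((r `^ p)^-1)%:E * \int[lebesgue_rV]_x (g x * Phi x).
  rewrite -ge0_integralZl//; last 3 first.
  - exact: emeasurable_funM.
  - by move=> x _; rewrite mule_ge0.
  - by rewrite lee_fin invr_ge0 ltW.
  have indE (A : set 'rV[R]_n) : measurable A -> lebesgue_rV A = \int[lebesgue_rV]_x (\1_A x)%:E.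
    by move=> mA; rewrite integral_indic// setIT.
  rewrite (indE Q)// (indE rD)//.
  have m1 : measurable_fun setT (fun x : 'rV[R]_n => (\1_rD x)%:E : \bar R).
    by apply/measurable_EFinP; exact: measurable_indic.
  have m2 : measurable_fun setT (fun x => ((r `^ p)^-1)%:E * (g x * Phi x)).
    exact: (emeasurable_funM (measurable_cst _) (emeasurable_funM mg mPhi)).
  have h2 x : 0 <= ((r `^ p)^-1)%:E * (g x * Phi x).
    by rewrite mule_ge0 ?lee_fin ?invr_ge0 ?(ltW rp0)// mule_ge0.
  rewrite -ge0_integralD//; apply: ge0_le_integral => //.
    exact: emeasurable_funD.
  move=> x _; rewrite /Phi /g -NE. rewrite -!EFinM -EFinD lee_fin.
  have [Nr|rN] := ltP (minkowski_functional D x) r.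
    have rDx : rD x by exact: (minkowski_functional_lt bD sD Nr).
    rewrite [X in (_ <= X + _)%R]indicE (mem_set rDx).
    apply: (@le_trans _ _ 1%R); first by rewrite indicE; case: (_ \in _).
    by rewrite lerDl mulr_ge0 ?invr_ge0 ?(ltW rp0)// mulr_ge0// powR_ge0.
  apply: (@le_trans _ _ ((r `^ p)^-1 * (\1_Q x * minkowski_functional D x `^ p))%R); last first.
    by rewrite lerDr.
  rewrite mulrCA; apply: ler_peMr => //; rewrite mulrC ler_pdivlMr// mul1r.
  apply: ge0_ler_powR => //; rewrite ?nnegrE ltW//.
  exact: lt_le_trans rN.
rewrite lebesgue_rV_cube lebesgue_rV_dilation// => h.
have : 1 <= (r ^+ n)%:E * lebesgue_rV D + (2^-1)%:E.
  apply: (le_trans h); apply: leeD => //.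
  apply: (@le_trans _ _ (((r `^ p)^-1)%:E * (r `^ p / 2)%:E)).
    by apply: lee_wpmul2l => //; rewrite lee_fin invr_ge0 ltW.
  by rewrite -EFinM lee_fin mulrA mulVf ?gt_eqF// mul1r.
rewrite -leeBlDr// -EFinD (_ : 1 - 2^-1 = 2^-1)%R//; lra.
Qed.

(* F plays the role of f extended by 0 outside K; since K is a subset of D, the
   integral of F ||x||_D ^ p is at most m, whereas in each direction theta the
   slab bound leaves mass m - 2 a M at |(x, theta)| > a. *)
Lemma Lp_ball_slab_bound n (p a m M : R)
    (nu : {finite_measure set 'rV[R]_n -> \bar R}) (F : 'rV[R]_n -> \bar R) :
  measurable_fun setT F -> (forall x, 0 <= F x) ->
  \int[lebesgue_rV]_x F x = m%:E ->
  (forall x, F x * \int[nu]_(theta in @unit_sphere R n) (`|dotp x theta| `^ p)%:E <= F x) ->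
  (forall theta, dotp theta theta = 1%R ->
    \int[lebesgue_rV]_(x in [set x | `|dotp x theta| <= a]%R) F x <= (2 * a * M)%:E) ->
  (0 < p)%R -> (0 < a)%R -> (0 <= M)%R ->
  (2 <= a `^ p * fine (nu (@unit_sphere R n)))%R ->
  (m <= 4 * a * M)%R.
Proof.
move=> mF F0 Fm FN slab p0 a0 M0 anu; set S := @unit_sphere R n in FN anu *.
have mS : measurable S by exact: measurable_unit_sphere.
have nuf : nu S \is a fin_num by exact: fin_num_measure.
have ap0 : (0 < a `^ p)%R by rewrite powR_gt0.
(* The mass outside a slab is at least [m - 2 * a * M] and is weighted there by at least [a ^ p], so
   [c] bounds [J theta] below for every unit [theta]. For [c <= 0] the claim is immediate. *)
pose c := (a `^ p * (m - 2 * a * M))%R.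
have [c0|c0] := leP c 0%R.
  have : (m - 2 * a * M <= 0)%R by rewrite -(pmulr_rle0 _ ap0).
  have : (0 <= a * M)%R by rewrite mulr_ge0// ltW.
  lra.
pose J theta := \int[lebesgue_rV]_x (F x * (`|dotp x theta| `^ p)%:E).
have cJ theta : S theta -> c%:E <= J theta.
  move=> /unit_sphere_dotp th1.
  set T := [set x : 'rV[R]_n | (`|dotp x theta| <= a)%R].
  have md : measurable_fun setT (fun x : 'rV[R]_n => `|dotp x theta|)%R.
    by apply: measurableT_comp => //; exact: measurable_dotp.
  have mT : measurable T.
    rewrite [X in measurable X](_ : _ = (fun x : 'rV[R]_n => `|dotp x theta|)%R @^-1` `]-oo, a]).
      by rewrite -[X in measurable X]setTI; exact: md.
    by apply/seteqP; split=> x; rewrite /T/= in_itv.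
  have mFT : measurable_fun setT (F \_ T).
    by apply/(measurable_restrictT _ mT); exact: measurable_funTS.
  have FT0 x : 0 <= (F \_ T) x by rewrite /patch; case: ifP.
  have mFd : measurable_fun setT (fun x : 'rV[R]_n => F x * (`|dotp x theta| `^ p)%:E).
    apply: emeasurable_funM => //; apply/measurable_EFinP.
    by apply: (measurableT_comp (measurable_normr_powR p)); exact: measurable_dotp.
  have Fd0 (x : 'rV[R]_n) : 0 <= F x * (`|dotp x theta| `^ p)%:E.
    by rewrite mule_ge0// lee_fin powR_ge0.
  have : (a `^ p)%:E * m%:E <= (a `^ p)%:E * (2 * a * M)%:E + J theta.
    apply: (@le_trans _ _ ((a `^ p)%:E * \int[lebesgue_rV]_x (F \_ T) x + J theta)); last first.
      apply: leeD => //; apply: lee_wpmul2l; first by rewrite lee_fin ltW.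
      by rewrite -integral_mkcond; exact: slab.
    rewrite -Fm -ge0_integralZl ?lee_fin ?(ltW ap0)// -ge0_integralZl ?lee_fin ?(ltW ap0)//.
    rewrite /J -ge0_integralD//; last 2 first.
    - by move=> x _; rewrite mule_ge0// lee_fin ltW.
    - exact: (emeasurable_funM (measurable_cst _) mFT).
    apply: ge0_le_integral => //.
    - by move=> x _; rewrite mule_ge0// lee_fin ltW.
    - exact: (emeasurable_funM (measurable_cst _) mF).
    - exact: (emeasurable_funD (emeasurable_funM (measurable_cst _) mFT) mFd).
    move=> x _; have [xT|xT] := boolP (x \in T).
      by rewrite /patch xT leeDl.
    rewrite /patch (negbTE xT) mule0 add0e muleC lee_wpmul2l// lee_fin.
    have xa : (a < `|dotp x theta|)%R.
      by rewrite ltNge; apply: contra xT => xa; rewrite inE.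
    by rewrite ge0_ler_powR ?nnegrE// ?ltW.
  by rewrite -!EFinM -leeBlDl// -EFinD /c mulrBr.
have : c%:E * nu S <= m%:E.
  rewrite -integral_cst//; apply: (@le_trans _ _ (\int[nu]_(theta in S) J theta)).
    apply: ge0_le_integral => //.
    - by move=> y _; rewrite lee_fin ltW.
    - exact: measurable_average_dual.
  rewrite /J -ge0_integral_mul_average// -Fm; apply: ge0_le_integral => //.
  - by move=> x _; rewrite mule_ge0//; apply: integral_ge0 => y _; rewrite lee_fin powR_ge0.
  - by apply: emeasurable_funM => //; exact: measurable_average.
rewrite -(fineK nuf) -EFinM lee_fin /c => h.
have mM : (0 <= m - 2 * a * M)%R by rewrite -(pmulr_rge0 _ ap0) ltW.
(* From [a ^ p * nu S >= 2] and [c * nu S <= m] follows 2 (m - 2 a M) <= m. *)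
have := ler_wpM2r mM anu; rewrite mulrAC -mulrA in h *; lra.
Qed.

End Lp_ball_bounds.

(** * The slicing inequality for one body D *)

Section slicing.
Context {R : realType}.
Local Open Scope ereal_scope.

Lemma Lp_ball_slicing n (D : set 'rV[R]_n) (p m M : R) (F : 'rV[R]_n -> \bar R) :
  (0 < n)%N -> (2 < p)%R -> Lp_ball p D ->
  measurable_fun setT F -> (forall x, 0 <= F x) -> (forall x, ~ D x -> F x = 0) ->
  \int[lebesgue_rV]_x F x = m%:E -> (0 <= M)%R ->
  (forall (theta : 'rV[R]_n) (a : R), dotp theta theta = 1%R -> (0 <= a)%R ->
    \int[lebesgue_rV]_(x in [set x | `|dotp x theta| <= a]%R) F x <= (2 * a * M)%:E) ->
  (m <= 64 * Num.sqrt p * fine (lebesgue_rV D) `^ n%:R^-1 * M)%R.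
Proof.
move=> n0 p2 [bD sD [nu [nuS NE]]] mF F0 FD Fm M0 slab.
have p0 : (0 < p)%R by exact: lt_trans p2.
have pN0 : p != 0%R by rewrite gt_eqF.
set nuS' := fine (nu (@unit_sphere R n)).
have nu0 : (0 <= nuS')%R by exact: fine_ge0.
have lDf : lebesgue_rV D \is a fin_num by apply: lebesgue_rV_compact_fin; case: bD.
pose d := fine (lebesgue_rV D); have d0 : (0 <= d)%R by exact: fine_ge0.
pose s := Num.sqrt p; have s0 : (0 < s)%R by rewrite sqrtr_gt0.
have vol (r : R) : (0 < r)%R -> (4 * nuS' * s `^ p <= r `^ p)%R -> (2^-1 <= r ^+ n * d)%R.
  by move=> r0 rp; have := Lp_ball_volume_ge bD sD NE p0 r0 rp; rewrite -(fineK lDf) -EFinM lee_fin.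
(* Were the mass zero, the volume bound would hold for every positive [r]. The choice r = 1 / (2 d +
   2) refutes it, since r^n d <= r d = 1/2 - r. *)
have nupos : (0 < nuS')%R.
  rewrite lt_neqAle nu0 andbT eq_sym; apply/negP => /eqP nuE.
  pose r := (2 * d + 2)^-1%R.
  have r0 : (0 < r)%R by rewrite invr_gt0 ltr_wpDl ?mulr_ge0.
  have r1 : (r <= 1)%R by rewrite invf_le1 ?ltr_wpDl ?mulr_ge0//; lra.
  have := vol r r0; rewrite nuE mulr0 mul0r => /(_ (powR_ge0 _ _)) h.
  have rn : (r ^+ n <= r)%R.
    by rewrite -{2}[r]expr1; apply: ler_wiXn2l => //; exact: ltW.
  have h2 : (2^-1 <= r * d)%R by apply: (le_trans h); exact: ler_wpM2r.
  have : (r * (2 * d + 2) = 1)%R by rewrite mulVf// gt_eqF// ltr_wpDl ?mulr_ge0.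
  lra.
pose a := ((2 / nuS') `^ p^-1)%R.
have a0 : (0 < a)%R by rewrite powR_gt0// divr_gt0.
have apE : (a `^ p = 2 / nuS')%R by rewrite -powRrM mulVf// powRr1// divr_ge0.
have ma : (m <= 4 * a * M)%R.
  apply: (Lp_ball_slab_bound (nu := nu) mF F0 Fm _ _ p0 a0 M0).
  - move=> x; rewrite -NE.
    have [Dx|/FD ->] := pselect (D x); last by rewrite mul0e.
    have /andP[N0 N1] := minkowski_functional_itv Dx.
    rewrite -[leRHS]mule1; apply: lee_wpmul2l => //.
    rewrite lee_fin; apply: (@le_trans _ _ (1 `^ p)%R); last by rewrite powR1.
    by apply: ge0_ler_powR; rewrite ?nnegrE// ltW.
  - by move=> theta th1; apply: slab => //; exact: ltW.
  - by rewrite apE divfK// gt_eqF.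
pose r := ((4 * nuS') `^ p^-1 * s)%R.
have r0 : (0 < r)%R by apply: mulr_gt0 => //; apply: powR_gt0; exact: mulr_gt0.
have rd : (2^-1 <= r ^+ n * d)%R.
  apply: vol => //; rewrite (powRM _ (powR_ge0 _ _) (ltW s0)) -powRrM mulVf//.
  by rewrite powRr1// mulr_ge0.
have nR : (1 <= n%:R :> R)%R by rewrite ler1n.
have nR0 : (n%:R != 0 :> R)%R by rewrite gt_eqF// (lt_le_trans _ nR).
(* Taking n-th roots costs nothing on the left: 1/2 is at most its own n-th root. *)
have rdn : (2^-1 <= r * d `^ n%:R^-1)%R.
  apply: (@le_trans _ _ (2^-1 `^ n%:R^-1)%R).
    apply: ger1_powR; last by rewrite invf_le1 ?(lt_le_trans _ nR).
    by apply/andP; split; lra.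
  have -> : (r * d `^ n%:R^-1 = (r ^+ n * d) `^ n%:R^-1)%R.
    rewrite powRM ?exprn_ge0 ?(ltW r0)//; congr (_ * _)%R.
    by rewrite -powR_mulrn ?(ltW r0)// -powRrM mulfV// powRr1// ltW.
  apply: ge0_ler_powR => //; rewrite ?nnegrE ?invr_ge0 ?ler0n//.
  by rewrite mulr_ge0// exprn_ge0// ltW.
(* The mass cancels, leaving 8^(1/p), which is at most 8 because [p] is at least 1. *)
have arE : (a * r <= 8 * s)%R.
  rewrite /r mulrA ler_pM2r// /a -powRM; last 2 first.
  - by rewrite divr_ge0.
  - by rewrite mulr_ge0.
  have -> : (2 / nuS' * (4 * nuS') = 8)%R by field; rewrite gt_eqF.
  rewrite -[leRHS]powRr1//; apply: ler_powR; first by lra.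
  by rewrite invf_le1//; lra.
apply: (le_trans ma).
have e0 : (0 <= d `^ n%:R^-1)%R by exact: powR_ge0.
have h1 : (4 * a * M <= 4 * a * M * (2 * (r * d `^ n%:R^-1)))%R.
  by apply: ler_peMr; [rewrite !mulr_ge0// ltW|lra].
apply: (le_trans h1).
have -> : (4 * a * M * (2 * (r * d `^ n%:R^-1)) = 8 * d `^ n%:R^-1 * M * (a * r))%R by ring.
have -> : (64 * s * d `^ n%:R^-1 * M = 8 * d `^ n%:R^-1 * M * (8 * s))%R by ring.
by apply: ler_wpM2l => //; rewrite !mulr_ge0.
Qed.

End slicing.

(** A coordinate direction places a bounded set inside one slab, which bounds the whole integral by
    a multiple of the supremum over hyperplanes. *)
Lemma exists_unit_vector_coord (R : realType) n : (0 < n)%N ->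
  exists2 e : 'rV[R]_n, dotp e e = 1 & forall (x : 'rV[R]_n) (B : R),
    (forall i, `|x ord0 i| <= B) -> `|dotp x e| <= B.
Proof.
case: n => // n _; exists (delta_mx 0 0); first by rewrite dotp_delta0 mxE !eqxx.
by move=> x B xB; rewrite dotpC dotp_delta0.
Qed.

Theorem theorem1p7 (R : realType) :
  exists C : R, 0 < C /\
  forall (n : nat) (K : set 'rV[R]_n) (f : 'rV[R]_n -> R) (p : R),
    (1 <= n)%N ->
    compact K ->
    (0 < lebesgue_rV K)%E ->
    measurable_fun K f ->
    (forall x, K x -> 0 <= f x) ->
    2 < p ->
    (\int[lebesgue_rV]_(x in K) (f x)%:E <=
      (C * Num.sqrt p)%:E * d_ovr p K * lebesgue_rV K `^ n%:R^-1 *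
      ereal_sup [set \int[hyperplane_measure H]_(x in K `&` H) (f x)%:E |
                 H in [set H' | affine_hyperplane H']])%E.
Proof.
exists 64; split => // n K f p n1 cK K0 mf f0 p2.
have mK := measurable_compact_rV cK.
have p0 : 0 < p by exact: lt_trans p2.
pose F : 'rV[R]_n -> \bar R := (fun x => (f x)%:E) \_ K.
have mF : measurable_fun setT F.
  by apply/(measurable_restrictT _ mK); exact/measurable_EFinP.
have F0 x : (0 <= F x)%E.
  by rewrite /F /patch; case: ifPn => //; rewrite inE lee_fin; exact: f0.
have FK x : ~ K x -> F x = 0%E.
  by move=> nKx; rewrite /F /patch memNset.
rewrite integral_mkcond -/F.
set M := ereal_sup _.
have FM (theta : 'rV[R]_n) (t : R) : dotp theta theta = 1 ->
    (\int[hyperplane_measure [set x | dotp x theta = t]]_(x in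
       [set x | dotp x theta = t]) F x <= M)%E.
  move=> th1; rewrite /F -integral_mkcondl; apply: ereal_sup_ubound.
  exists [set x | dotp x theta = t] => //=; exists theta, t; split => //.
  apply/eqP => th0; move: th1; rewrite th0 /dotp big1 => [/eqP|i _].
    by rewrite eq_sym oner_eq0.
  by rewrite mxE mul0r.
have [e e1 eB] := @exists_unit_vector_coord R n n1.
have M0 : (0 <= M)%E.
  by apply: le_trans (FM e 0 e1); exact: integral_ge0.
have slab (theta : 'rV[R]_n) (a : R) : dotp theta theta = 1 -> 0 <= a ->
    (\int[lebesgue_rV]_(x in [set x | `|dotp x theta| <= a]%R) F x <= (2 * a)%:E * M)%E.
  by move=> th1 a0; apply: integral_slab => // t; exact: FM.
have [B B0 KB] := compact_coord_bounded cK.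
have FB : (\int[lebesgue_rV]_x F x <= (2 * B)%:E * M)%E.
  apply: le_trans (slab e B e1 B0); rewrite [leRHS]integral_mkcond.
  rewrite le_eqVlt; apply/orP; left; apply/eqP/eq_integral => x _.
  rewrite /patch; case: ifPn => // xB; apply: FK => Kx.
  by move: xB; rewrite notin_setE; apply; apply: eB; exact: KB.
have Kf := lebesgue_rV_compact_fin cK.
pose k := fine (lebesgue_rV K).
have KE : lebesgue_rV K = k%:E by rewrite fineK.
have k0 : 0 < k by rewrite -lte_fin -KE.
have s0 : 0 < Num.sqrt p by rewrite sqrtr_gt0.
have kn0 : 0 < k `^ n%:R^-1 by rewrite powR_gt0.
have d_ovr_ge (c : R) : (forall D, K `<=` D -> Lp_ball p D ->
    c <= fine (lebesgue_rV D) `^ n%:R^-1 / k `^ n%:R^-1) -> (c%:E <= d_ovr p K)%E.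
  move=> h; apply: le_ereal_inf_tmp => _ [D [KD LD] <-].
  have Df : lebesgue_rV D \is a fin_num by case: LD => -[cD _ _] _ _; exact: lebesgue_rV_compact_fin.
  rewrite KE inver gt_eqF// -(fineK Df) -EFinM poweR_EFin lee_fin.
  rewrite powRM ?fine_ge0 ?invr_ge0 ?(ltW k0)//.
  have -> : k^-1 `^ n%:R^-1 = (k `^ n%:R^-1)^-1.
    by rewrite -(powR_inv1 (ltW k0)) -powRrM mulN1r powRN.
  exact: h.
(* Positivity of the outer volume ratio matters when the supremum is infinite: the convention 0 * oo
   = 0 would otherwise spoil the right-hand side. *)
have d1 : (1 <= d_ovr p K)%E.
  apply: d_ovr_ge => D KD LD; rewrite ler_pdivlMr// mul1r.
  have cD : compact D by case: LD => -[].
  have Df := lebesgue_rV_compact_fin cD.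
  apply: ge0_ler_powR; rewrite ?nnegrE ?invr_ge0 ?ler0n ?fine_ge0//.
  apply: fine_le => //; apply: le_measure => //; rewrite inE//.
  exact: measurable_compact_rV.
rewrite KE poweR_EFin.
have C0 : 0 < 64 * Num.sqrt p by rewrite mulr_gt0.
move: M0 slab FB; case: M {FM} => [M|_ _ _|//]; last first.
  rewrite gt0_muley ?leey// mule_gt0// mule_gt0 ?lte_fin//.
  exact: lt_le_trans d1.
rewrite lee_fin => M0 slab FB.
have Ff : (\int[lebesgue_rV]_x F x)%E \is a fin_num.
  by rewrite ge0_fin_numE; [apply: le_lt_trans FB _; rewrite ltry|exact: integral_ge0].
pose m := fine (\int[lebesgue_rV]_x F x)%E.
have FmE : (\int[lebesgue_rV]_x F x)%E = m%:E by rewrite fineK.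
(* When [M] is 0 the right-hand side vanishes, and [FB] shows that the integral does too. This
   leaves [M] positive, so that one may divide by it. *)
have [M00|Mpos] := eqVneq M 0.
  by rewrite M00 mule0; apply: (le_trans FB); rewrite M00 mule0.
have {}Mpos : 0 < M by rewrite lt_neqAle eq_sym Mpos.
(* [W] gathers all factors but [d_ovr p K]. The goal becomes the lower bound [m / W] for an infimum,
   which is checked on each admissible D without choosing a near-optimal one. *)
pose W := 64 * Num.sqrt p * k `^ n%:R^-1 * M.
have W0 : 0 < W by rewrite !mulr_gt0.
have : ((m / W)%:E <= d_ovr p K)%E.
  apply: d_ovr_ge => D KD LD; rewrite ler_pdivrMr//.
  have := Lp_ball_slicing n1 p2 LD mF F0 (fun x nDx => FK x (fun Kx => nDx (KD x Kx))) FmE M0 slab.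
  rewrite /W; set u := fine _ `^ _.
  have -> : u / k `^ n%:R^-1 * (64 * Num.sqrt p * k `^ n%:R^-1 * M) =
    64 * Num.sqrt p * u * M by field; rewrite gt_eqF.
  exact.
rewrite FmE => mW.
rewrite [X in (X * _ * _)%E]muleC -!muleA -!EFinM mulrA -/W.
have -> : (m%:E = (m / W)%:E * W%:E)%E by rewrite -EFinM divfK// gt_eqF.
by apply: lee_wpmul2r => //; rewrite lee_fin ltW.
Qed.
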